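(* Let $P=P^n$ be a simple polytope with $m$ facets and characteristic function $\lambda:\mathbb{Z}^m\to\mathbb{Z}^n$. For $i=1,\dots,m$ let $P_i$ be a simple polytope of dimension $n_i$ with $j_i$ facets and characteristic function $\lambda_i:\mathbb{Z}^{j_i}\to\mathbb{Z}^{n_i}$. Put $d(J)=j_1+\cdots+j_m$ and $N=n_1+\cdots+n_m$. Then there is a homotopy equivalence of orbit spaces $$Z\big(K_P;(\underline{CZ(K_{P_i})},\underline{Z(K_{P_i})})\big)/\ker\lambda(J,N)\ \simeq\ Z\big(K_{P(P_1,P_2,\dots,P_m)};(D^2,S^1)\big)/\ker\lambda(J,N),$$ where $K_{P(P_1,\dots,P_m)}$ is the nerve complex of the $d(J)$-faceted, $(n+N)$-dimensional polytope $P(P_1,\dots,P_m)$, and $\ker\lambda(J,N)\subset T^{d(J)}$ is isomorphic to a torus of dimension $d(J)-(n+N)$.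
   Context: A polytope of dimension $n$ is simple if exactly $n$ facets meet at each vertex. For a simple polytope $Q$, $K_Q$ is the simplicial complex dual to its boundary: vertices correspond to facets, and a set of vertices is a simplex iff the corresponding facets have non-empty intersection. A characteristic function on a simple polytope $Q$ of dimension $q$ with facets $F_1,\dots,F_r$ is a map $\mu:\{F_1,\dots,F_r\}\to\mathbb{Z}^q$, equivalently a $q\times r$ integer matrix $\mathbb{Z}^r\to\mathbb{Z}^q$, such that whenever $F_{i_1}\cap\cdots\cap F_{i_l}$ is a codimension-$l$ face, $\mu(F_{i_1}),\dots,\mu(F_{i_l})$ span a rank-$l$ direct summand of $\mathbb{Z}^q$. Polyhedral products: for a simplicial complex $K$ on $r$ vertices and pairs $(A_i,B_i)$, $Z(K;(\underline{A_i},\underline{B_i}))=\bigcup_{\sigma\in K}\prod_{i=1}^rC_i(\sigma)$, with $C_i(\sigma)=A_i$ if $i\in\sigma$ and $C_i(\sigma)=B_i$ if $i\notin\sigma$. With all pairs $(D^2,S^1)$ this is the moment-angle complex $Z(K)=Z(K;(D^2,S^1))\subseteq(D^2)^r$, with coordinatewise action of $T^r$. $CX$ is the cone on $X$, with $X\subset CX$ as its base; group actions extend to the cone preserving the cone parameter. $P(P_1,\dots,P_m)$ is the polytope obtained by Ayzenberg's composition construction; it need not be simple. Its nerve complex is the composed complex $K_{P(P_1,\dots,P_m)}=K_P(K_{P_1},\dots,K_{P_m})$, where $K(K_1,\dots,K_m)=\bigcup_{\sigma\in K}B_1(\sigma)*\cdots*B_m(\sigma)\subset\Delta^{j_1-1}*\cdots*\Delta^{j_m-1}$,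 with $B_i(\sigma)=\Delta^{j_i-1}$ (the full simplex on the vertex set of $K_i$) if $i\in\sigma$ and $B_i(\sigma)=K_i$ if $i\notin\sigma$. The matrix $\lambda(J,N)$: write the $n_i\times j_i$ matrix $\lambda_i$ as $(\overline{\lambda}_i\mid c_i)$, with $\overline{\lambda}_i$ its first $j_i-1$ columns and $c_i$ its last column. Then $\lambda(J,N)$ is the $(n+N)\times d(J)$ integer matrix with $m+1$ row blocks of sizes $n_1,\dots,n_m,n$ and $m+1$ column blocks of sizes $j_1-1,\dots,j_m-1,m$. For $i\le m$, row block $i$ has $\overline{\lambda}_i$ in column block $i$, has $c_i$ as the $i$-th column of the last column block, and is zero elsewhere. The last row block is zero in the first $m$ column blocks and equals $\lambda$ in the last column block. The columns of column block $i$ together with the $i$-th column of the last block correspond, in order, to the facets of $P_i$, i.e. to the coordinates of $T^{j_i}$ in $T^{d(J)}=T^{j_1}\times\cdots\times T^{j_m}$. $\ker\lambda(J,N)$ is the kernel of the induced homomorphism of tori $T^{d(J)}\to T^{n+N}$. It acts on the two spaces in the theorem through the coordinatewise actions of $T^{d(J)}$. *)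

(* Defs.v *)
From HB Require Import structures.
From mathcomp Require Import all_boot all_order all_algebra.
From mathcomp Require Import complex.
From mathcomp Require Import all_classical all_reals all_analysis.

Set Implicit Arguments.
Unset Strict Implicit.
Unset Printing Implicit Defensive.

Import Order.TTheory GRing.Theory Num.Theory.
Import numFieldTopology.Exports numFieldNormedType.Exports.

Local Open Scope classical_set_scope.
Local Open Scope ring_scope.
Local Open Scope complex_scope.
Local Open Scope quotient_scope.

(* The complex plane gets its topology from its norm, as a numFieldType. *)
HB.instance Definition _ (R : realType) :=
  NormedModule.copy R[i] (R[i] : numFieldType)^o.

Definition dotmx (R : realType) n (u x : 'rV[R]_n) : R := (u *m x^T) 0 0.

(* W is (a matrix spanning) the direction space of the affine hull of S; the
   empty set has no dimension. *)
Definition has_dim (R : realType) n (S : set 'rV[R]_n) (d : nat) : Prop :=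
  exists (x0 : 'rV[R]_n) (W : 'M[R]_n),
    [/\ S x0, \rank W = d, forall x, S x -> (x - x0 <= W)%MS &
        forall W' : 'M[R]_n, (forall x, S x -> (x - x0 <= W')%MS) ->
          (W <= W')%MS].

(* Nonempty faces; u = 0 gives the improper face S. *)
Definition is_face (R : realType) n (S F : set 'rV[R]_n) : Prop :=
  F !=set0 /\ exists (u : 'rV[R]_n) (c : R),
    (forall x, S x -> dotmx u x <= c) /\ F = [set x | S x /\ dotmx u x = c].

Definition codim_face (R : realType) n (S : set 'rV[R]_n) (l : nat)
    (F : set 'rV[R]_n) : Prop :=
  is_face S F /\ exists d, has_dim F d /\ (d + l = n)%N.

Record ineqs (R : realType) (n : nat) (I : finType) := Ineqs {
  normal : I -> 'rV[R]_n;
  offset : I -> R }.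

Definition slack (R : realType) n (I : finType) (P : ineqs R n I) (i : I)
    (x : 'rV[R]_n) : R :=
  dotmx (normal P i) x + offset P i.

Definition polyhedron (R : realType) n (I : finType) (P : ineqs R n I) :
    set 'rV[R]_n :=
  [set x | forall i, 0 <= slack P i x].

Definition facet (R : realType) n (I : finType) (P : ineqs R n I) (i : I) :
    set 'rV[R]_n :=
  [set x | polyhedron P x /\ slack P i x = 0].

Definition facet_meet (R : realType) n (I : finType) (P : ineqs R n I)
    (s : {set I}) : set 'rV[R]_n :=
  [set x | polyhedron P x /\ forall i, i \in s -> facet P i x].

(* P presents an n-dimensional polytope in R^n whose facets are, without
   repetition, the sets facet P i. *)
Definition polytope (R : realType) n (I : finType) (P : ineqs R n I) : Prop :=
  [/\ exists M : R, forall x, polyhedron P x -> forall a, `|x 0 a| <= M,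
      has_dim (polyhedron P) n &
      set_bij [set: I] [set F | codim_face (polyhedron P) 1 F] (facet P)].

Definition simple_polytope (R : realType) n (I : finType) (P : ineqs R n I) :
    Prop :=
  polytope P /\ forall v, is_face (polyhedron P) [set v] ->
    #|[set i | slack P i v == 0]%SET| = n.

Definition nerve (R : realType) n (I : finType) (P : ineqs R n I) :
    set {set I} :=
  [set s | facet_meet P s !=set0].

Definition int_span p l (M : 'M[int]_(p, l)) : set 'cV[int]_p :=
  range (fun c : 'cV[int]_l => M *m c).

Definition direct_summand p (S : set 'cV[int]_p) : Prop :=
  exists S' : set 'cV[int]_p,
    [/\ S' 0, forall u v, S' u -> S' v -> S' (u - v),
        forall v, exists s s', [/\ S s, S' s' & v = s + s'] &
        S `&` S' = [set 0]].

(* Column i of mu is the value of the characteristic function on facet i. *)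
Definition characteristic (R : realType) n r (P : ineqs R n 'I_r)
    (mu : 'M[int]_(n, r)) : Prop :=
  forall s : {set 'I_r}, codim_face (polyhedron P) #|s| (facet_meet P s) ->
    let M := colsub (fun c : 'I_#|s| => enum_val c) mu in
    \rank (map_mx (intr : int -> rat) M) = #|s| /\ direct_summand (int_span M).

Section Composition.
Variables (m : nat) (j : 'I_m -> nat).

Definition slice (tau : {set {i & 'I_(j i)}}) (i : 'I_m) : {set 'I_(j i)} :=
  [set a | Tagged (fun i => 'I_(j i)) a \in tau]%SET.

Definition composed_complex (K : set {set 'I_m})
    (Ks : forall i, set {set 'I_(j i)}) : set {set {i & 'I_(j i)}} :=
  \bigcup_(s in K) [set tau | forall i : 'I_m,
    (if i \in s then setT else Ks i) (slice tau i)].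

(* The composed polytope is
     { (x, u_1, ..., u_m) | x in P, u_i in s_i(x) . P_i for all i },
   where s_i(x) >= 0 is the i-th slack of x, that is, the i-th coordinate of
   the embedding of P in the orthant R^m_+.  Homogenizing the inequality
   <a, u> + b >= 0 of P_i gives  <a, u_i> + b * s_i(x) >= 0, one inequality per
   facet of P_i; these imply s_i(x) >= 0 since P_i is bounded and
   full-dimensional. *)
Definition composed_polytope (R : realType) n (nn : 'I_m -> nat)
    (P : ineqs R n 'I_m) (Q : forall i, ineqs R (nn i) 'I_(j i)) :
    ineqs R (n + \sum_i nn i) {i & 'I_(j i)} :=
  Ineqs
    (fun p => row_mx
       (offset (Q (tag p)) (tagged p) *: normal P (tag p))
       (\mxrow_i (if i == tag p
                  then conform_mx 0 (normal (Q (tag p)) (tagged p))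
                  else 0)))
    (fun p => offset (Q (tag p)) (tagged p) * offset P (tag p)).

End Composition.

Definition polyhedral_product (V : finType) (X : V -> topologicalType)
    (K : set {set V}) (A B : forall v, set (X v)) : set (prod_topology X) :=
  \bigcup_(s in K) [set x | forall v, (if v \in s then A v else B v) (x v)].

Definition unit_disc (R : realType) : set R[i] := [set z | `|z| <= 1].
Definition unit_circle (R : realType) : set R[i] := [set z | `|z| = 1].
Arguments unit_disc R : clear implicits.
Arguments unit_circle R : clear implicits.

Definition moment_angle (R : realType) (V : finType) (K : set {set V}) :
    set (prod_topology (fun _ : V => R[i])) :=
  polyhedral_product (X := fun=> R[i]) K
    (fun=> unit_disc R) (fun=> unit_circle R).
Arguments moment_angle R {V} K.

Definition torus (R : realType) (V : finType) : Type :=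
  prod_topology (fun _ : V => set_type (unit_circle R)).
HB.instance Definition _ R V := Topological.on (torus R V).

Lemma unit_circleM (R : realType) (s t : unit_circle R) :
  val s * val t \in unit_circle R.
Proof.
by apply/mem_set; rewrite /unit_circle/= normrM (set_valP s) (set_valP t) mul1r.
Qed.

Definition torus_mul (R : realType) V (s t : torus R V) : torus R V :=
  fun v => exist _ (val (s v) * val (t v)) (unit_circleM (s v) (t v)).

Definition torus_act (R : realType) V (t : torus R V)
    (z : prod_topology (fun _ : V => R[i])) : prod_topology (fun _ => R[i]) :=
  fun v => val (t v) * z v.

Lemma moment_angle_torus_act (R : realType) V (K : set {set V})
    (t : torus R V) (z : moment_angle R K) :
  torus_act t (val z) \in moment_angle R K.
Proof.
case: z => z /= /set_mem[s Ks zs]; apply/mem_set; exists s => // v.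
have tv : `|val (t v)| = 1 := set_valP (t v).
move: (zs v); rewrite /torus_act; case: ifP => _;
  by rewrite /unit_disc /unit_circle/= normrM tv mul1r.
Qed.

Definition moment_angle_act (R : realType) V (K : set {set V})
    (t : torus R V) (z : moment_angle R K) : moment_angle R K :=
  exist _ (torus_act t (val z)) (moment_angle_torus_act t z).

Definition unit_interval (R : realType) : set R := `[0, 1].
Arguments unit_interval R : clear implicits.

Lemma unit_interval0 (R : realType) : (0 : R) \in unit_interval R.
Proof. by apply/mem_set; rewrite /unit_interval/= in_itv/= lexx ler01. Qed.

Section Cone.
Variables (R : realType) (X : topologicalType).

(* The base is at parameter 0 and the apex at parameter 1. *)
Definition cone_rel (p q : X * unit_interval R) : bool :=
  (p == q) || ((val p.2 == 1) && (val q.2 == 1)).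

Lemma cone_rel_refl : reflexive cone_rel.
Proof. by move=> p; rewrite /cone_rel eqxx. Qed.

Lemma cone_rel_sym : symmetric cone_rel.
Proof. by move=> p q; rewrite /cone_rel eq_sym andbC. Qed.

Lemma cone_rel_trans : transitive cone_rel.
Proof.
move=> q p r /predU1P[-> //|/andP[p1 q1]] /predU1P[<-|/andP[_ r1]];
  by rewrite /cone_rel p1 ?q1 ?r1 orbT.
Qed.

Definition cone_equiv := EquivRel _ cone_rel_refl cone_rel_sym cone_rel_trans.

Definition cone := {eq_quot cone_equiv}.
HB.instance Definition _ := Topological.copy cone (quotient_topology cone).
HB.instance Definition _ := Quotient.on cone.

Definition cone_base (x : X) : cone :=
  \pi_cone (x, exist _ 0 (unit_interval0 R)).

(* All representatives of the apex have parameter 1, so the choice made by repr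
   does not matter. *)
Definition cone_map (f : X -> X) (c : cone) : cone :=
  \pi_cone (f (repr c).1, (repr c).2).

End Cone.

(* H acts on the ambient space X; two points of Y are identified when they have
   the same H-orbit in X. *)
Section OrbitSpace.
Variables (G : Type) (X : topologicalType) (act : G -> X -> X).
Variables (H : set G) (Y : set X).

Definition orbit_of (x : X) : set X := [set act g x | g in H].

Definition orbit_rel (x y : Y) : bool :=
  `[< orbit_of (val x) = orbit_of (val y) >].

Lemma orbit_rel_refl : reflexive orbit_rel.
Proof. by move=> x; exact/asboolP. Qed.

Lemma orbit_rel_sym : symmetric orbit_rel.
Proof. by move=> x y; apply/asboolP/asboolP => ->. Qed.

Lemma orbit_rel_trans : transitive orbit_rel.
Proof. by move=> y x z /asboolP xy /asboolP yz; apply/asboolP; rewrite xy. Qed.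

Definition orbit_equiv :=
  EquivRel _ orbit_rel_refl orbit_rel_sym orbit_rel_trans.

Definition orbit_space := {eq_quot orbit_equiv}.
HB.instance Definition _ :=
  Topological.copy orbit_space (quotient_topology orbit_space).
HB.instance Definition _ := Quotient.on orbit_space.

End OrbitSpace.

Definition homotopic (R : realType) (X Y : topologicalType) (f g : X -> Y) :
    Prop :=
  exists H : X * unit_interval R -> Y,
    [/\ continuous H,
        forall x (t : unit_interval R), val t = 0 -> H (x, t) = f x &
        forall x (t : unit_interval R), val t = 1 -> H (x, t) = g x].

Definition homotopy_equivalent (R : realType) (X Y : topologicalType) : Prop :=
  exists (f : X -> Y) (g : Y -> X),
    [/\ continuous f, continuous g,
        homotopic R (g \o f) id & homotopic R (f \o g) id].

Section LambdaJN.
Variables (R : realType) (n m : nat) (lam : 'M[int]_(n, m)).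
Variables (nn k : 'I_m -> nat).
(* j_i = k i + 1, so that lams i = (lsubmx (lams i) | rsubmx (lams i)). *)
Variable lams : forall i, 'M[int]_(nn i, k i + 1).

Definition lambdaJN : 'M[int]_(\sum_i nn i + n, \sum_i k i + m) :=
  block_mx
    (\mxblock_(i, i') (if i == i' then conform_mx 0 (lsubmx (lams i)) else 0))
    (\mxcol_i (rsubmx (lams i) *m delta_mx 0 i))
    0
    lam.

(* The coordinate of T^{d(J)} = T^{j_1} x ... x T^{j_m} that corresponds to a
   column of lambda(J, N). *)
Definition column_coord (c : 'I_(\sum_i k i + m)) : {i & 'I_(k i + 1)} :=
  match fintype.split c with
  | inl c' => Tagged (fun i => 'I_(k i + 1)) (lshift 1 (tagnat.sig2 c'))
  | inr i => Tagged (fun i => 'I_(k i + 1)) (rshift (k i) (ord0 : 'I_1))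
  end.

Definition ker_lambdaJN : set (torus R {i & 'I_(k i + 1)}) :=
  [set t | forall r,
    \prod_c val (t (column_coord c)) ^ (lambdaJN r c) = 1].

End LambdaJN.
Arguments ker_lambdaJN R {n m} lam {nn k} lams.

Section CompositionSpaces.
Variables (R : realType) (m : nat) (j : 'I_m -> nat).

Definition cone_moment_angle (Ks : forall i, set {set 'I_(j i)}) (i : 'I_m) :
    topologicalType :=
  cone R (moment_angle R (Ks i)).

Definition cone_product (K : set {set 'I_m})
    (Ks : forall i, set {set 'I_(j i)}) :
    set (prod_topology (cone_moment_angle Ks)) :=
  polyhedral_product (X := cone_moment_angle Ks) K
    (fun=> setT) (fun i => range (@cone_base R (moment_angle R (Ks i)))).

Definition cone_product_act (Ks : forall i, set {set 'I_(j i)})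
    (t : torus R {i & 'I_(j i)}) (x : prod_topology (cone_moment_angle Ks)) :
    prod_topology (cone_moment_angle Ks) :=
  fun i => cone_map
    (moment_angle_act (fun a => t (Tagged (fun i => 'I_(j i)) a))) (x i).

End CompositionSpaces.
Arguments cone_product R {m j} K Ks.
Arguments cone_product_act {R m j} Ks t x.

Definition iso_to_torus (R : realType) (V : finType) (H : set (torus R V))
    (q : nat) : Prop :=
  exists (f : torus R 'I_q -> torus R V) (g : torus R V -> torus R 'I_q),
    [/\ continuous f, {within H, continuous g},
        {morph f : s t / torus_mul s t}, cancel f g & range f = H].

(* Main.v *)
(** For a simplicial complex K on V without the full simplex, the map
    [z, t] |-> (1 - t) z embeds the cone on Z(K) equivariantly in C^V.  Its image
    is the set of z with |z_v| <= depth(z) for all v, where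
    depth(z) = min(1, max_(s in K) min_(v notin s) |z_v|), and truncating each
    coordinate to modulus depth(z) retracts C^V onto it, equivariantly and fixing
    Z(K).  Taken factor by factor, this makes Z(K_P; (CZ(K_i), Z(K_i))) an
    equivariant deformation retract, along straight lines, of
    Z(K_P; ((D^2)^j_i, Z(K_i))) = Z(K_P(K_1, ..., K_m)), and the deformation
    descends to orbit spaces since orbit maps are open.

    A point of a polytope farthest from a given point is a vertex; hence each P_i
    has a vertex off its last facet, so that the first j_i - 1 columns of lambda_i
    already span, and lambda(J, N) is surjective by block triangularity.  A Smith
    normal form then splits off its kernel as a torus. *)

From HB Require Import structures.
From mathcomp Require Import all_boot all_order all_algebra.
From mathcomp Require Import complex.
From mathcomp Require Import all_classical all_reals all_analysis.
From mathcomp Require Import zify ring lra.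
Require Import Defs.

Set Implicit Arguments.
Unset Strict Implicit.
Unset Printing Implicit Defensive.

Import Order.TTheory GRing.Theory Num.Theory.
Import numFieldTopology.Exports numFieldNormedType.Exports.

Local Open Scope classical_set_scope.
Local Open Scope ring_scope.
Local Open Scope complex_scope.
Local Open Scope quotient_scope.

(** * Polytopes and the composition *)

(** The cone carries a quotient topology, and picking representatives gives no continuity: the
    inverse of the embedding is continuous only because the cone on Z(K) is compact and C^V is
    Hausdorff. The depth is built to recover the cone parameter, being 1 - t at (1 - t) z; the
    absence of the full simplex is what bounds it above. Depth and truncation factors depend on
    moduli alone, whence equivariance.

    On the polytope side, facets given as codimension-one faces are traded for strict inequalities
    (an interior point, and for each facet a point on that facet only), because such points can be
    written down for the composed polytope. Its fibre over x in slot i is P_i scaled by the i-th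
    slack of x. The fibre collapses over facet i, and this produces the full simplices of the
    composed complex. *)

Section Dot.
Variables (R : realType) (n : nat).
Implicit Types (u x y w : 'rV[R]_n) (S T : set 'rV[R]_n).

Lemma dotmxE u x : dotmx u x = \sum_a u 0 a * x 0 a.
Proof. by rewrite /dotmx mxE; apply: eq_bigr => a _; rewrite mxE. Qed.

Lemma dotmxC u x : dotmx u x = dotmx x u.
Proof. by rewrite !dotmxE; apply: eq_bigr => a _; rewrite mulrC. Qed.

Lemma dotmx_is_linear u : linear (dotmx u : 'rV[R]_n -> R^o).
Proof.
by move=> a x y; rewrite /dotmx linearP /= mulmxDr -scalemxAr !mxE.
Qed.

HB.instance Definition _ u := GRing.isLinear.Build R 'rV[R]_n R^o _ (dotmx u)
  (dotmx_is_linear u).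

Lemma dotmxZl a u x : dotmx (a *: u) x = a * dotmx u x.
Proof. by rewrite dotmxC linearZ /= dotmxC. Qed.

Lemma dotmxZr a u x : dotmx u (a *: x) = a * dotmx u x.
Proof. by rewrite linearZ. Qed.

Lemma dotmxNl u x : dotmx (- u) x = - dotmx u x.
Proof. by rewrite dotmxC linearN /= dotmxC. Qed.

Lemma dotmx_ge0 x : 0 <= dotmx x x.
Proof. by rewrite dotmxE sumr_ge0 // => a _; rewrite -expr2 sqr_ge0. Qed.

Lemma dotmx_eq0 x : dotmx x x = 0 -> x = 0.
Proof.
rewrite dotmxE => /eqP; rewrite psumr_eq0 => [|a _]; last first.
  by rewrite -expr2 sqr_ge0.
move=> /allP x0; apply/rowP => a; rewrite mxE.
by have := x0 a (mem_index_enum _); rewrite /= -expr2 sqrf_eq0 => /eqP.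
Qed.

Lemma sub_kermx_dot u x : (x <= kermx u^T)%MS = (dotmx u x == 0).
Proof.
apply/sub_kermxP/eqP => [xu|ux]; first by rewrite dotmxC /dotmx xu mxE.
by apply/matrixP => a b; rewrite !ord1 -[LHS]/(dotmx x u) dotmxC ux mxE.
Qed.

Lemma has_dim_at S d x0 : has_dim S d -> S x0 ->
  exists W : 'M[R]_n, [/\ \rank W = d, forall x, S x -> (x - x0 <= W)%MS &
    forall W' : 'M[R]_n, (forall x, S x -> (x - x0 <= W')%MS) -> (W <= W')%MS].
Proof.
move=> [x1 [W [Sx1 rW WS Wmin]]] Sx0; exists W; split=> // [x Sx|W' W'S].
  have -> : x - x0 = (x - x1) - (x0 - x1) by rewrite opprB addrA subrK.
  by rewrite addmx_sub ?eqmx_opp ?WS.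
apply: Wmin => x Sx.
have -> : x - x1 = (x - x0) - (x1 - x0) by rewrite opprB addrA subrK.
by rewrite addmx_sub ?eqmx_opp ?W'S.
Qed.

Lemma has_dim_unique S d d' : has_dim S d -> has_dim S d' -> d = d'.
Proof.
move=> dS [x0 [W [Sx0 <- WS Wmin]]].
have [W' [<- W'S W'min]] := has_dim_at dS Sx0.
by apply/eqP; rewrite eqn_leq !mxrankS ?Wmin ?W'min.
Qed.

(** The direction space of [S] lies in that of [T] and has the same rank, so the two coincide, and a
    functional killing one kills the other. *)
Lemma same_dim_hyperplane S T d x0 u c : S `<=` T -> has_dim S d ->
  has_dim T d -> S x0 -> (forall x, S x -> dotmx u x = c) ->
  forall x, T x -> dotmx u x = c.
Proof.
move=> ST dS dT Sx0 uS x Tx.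
have [W [rW WS Wmin]] := has_dim_at dS Sx0.
have [W' [rW' W'T W'min]] := has_dim_at dT (ST _ Sx0).
have WW' : (W <= W')%MS by apply: Wmin => y /ST; exact: W'T.
have W'W : (W' <= W)%MS by rewrite -(mxrank_leqif_sup WW') rW rW'.
have Wu : (W <= kermx u^T)%MS.
  by apply: Wmin => y Sy; rewrite sub_kermx_dot linearB /= !uS // subrr.
have : (x - x0 <= kermx u^T)%MS.
  by apply: submx_trans Wu; apply: submx_trans W'W; exact: W'T.
by rewrite sub_kermx_dot linearB /= subr_eq0 (uS x0) // => /eqP.
Qed.

End Dot.

Section Polyhedron.
Variables (R : realType) (n : nat) (I : finType) (P : ineqs R n I).
Implicit Types (u x y w : 'rV[R]_n) (i j : I).
Local Notation S := (polyhedron P).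

Lemma slackD i x w : slack P i (x + w) = slack P i x + dotmx (normal P i) w.
Proof. by rewrite /slack linearD /= addrAC. Qed.

(** Tight inequalities do not change along [w], and the finitely many strict ones survive a short
    step. The [1 +] in the denominator of [q] avoids dividing by zero. *)
Lemma perturb x w : S x ->
  (forall i, slack P i x = 0 -> dotmx (normal P i) w = 0) ->
  exists2 e, 0 < e & forall t, `|t| <= e -> S (x + t *: w).
Proof.
move=> Sx xw.
pose q i := slack P i x / (1 + `|dotmx (normal P i) w|).
have d0 i : 0 < 1 + `|dotmx (normal P i) w| by rewrite ltr_pwDl.
exists (\big[Num.min/1]_(i | 0 < slack P i x) q i).
  by apply/bigmin_gtP; split=> // i si; rewrite divr_gt0.
move=> t /bigmin_geP[_ tP] i; rewrite slackD dotmxZr.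
have := Sx i; rewrite le_eqVlt => /predU1P[/esym s0|si].
  by rewrite s0 xw // mulr0 addr0.
have : `|t| * `|dotmx (normal P i) w| <= slack P i x.
  have := tP i si; rewrite ler_pdivlMr // mulrDr mulr1.
  by apply: le_trans; rewrite lerDr.
by rewrite -normrM ler_norml => /andP[+ _]; rewrite -subr_ge0 opprK addrC.
Qed.

(** The barycentre of the [y k]: a slack is positive there as soon as it is positive at one of the
    points. It merges pointwise witnesses into a single one. *)
Lemma average (J : finType) (y : J -> 'rV[R]_n) (k0 : J) :
  (forall k, S (y k)) -> exists x,
  [/\ S x, forall i k, 0 < slack P i (y k) -> 0 < slack P i x &
      forall u c, (forall k, dotmx u (y k) = c) -> dotmx u x = c].
Proof.
move=> Sy; have J0 : (0 : R) < #|J|%:R.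
  by rewrite ltr0n; apply/card_gt0P; exists k0.
have sJ (c : R) : \sum_(k : J) c = #|J|%:R * c.
  by rewrite sumr_const mulr_natl.
pose x := #|J|%:R^-1 *: \sum_k y k.
have xE u : dotmx u x = #|J|%:R^-1 * \sum_k dotmx u (y k).
  by rewrite dotmxZr linear_sum.
have sE i : slack P i x = #|J|%:R^-1 * \sum_k slack P i (y k).
  by rewrite /slack big_split /= sJ xE mulrDr mulKf ?gt_eqF.
exists x; split=> [i|i k yk|u c uc].
- by rewrite sE mulr_ge0 ?invr_ge0 ?ler0n ?sumr_ge0 // => k _; exact: Sy.
- rewrite sE mulr_gt0 ?invr_gt0 // (bigD1 k) //= ltr_pwDl //.
  by rewrite sumr_ge0 // => l _; exact: Sy.
- by rewrite xE (eq_bigr _ (fun k _ => uc k)) sJ mulKf ?gt_eqF.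
Qed.

Lemma has_dim_interior x0 : (forall i, 0 < slack P i x0) -> has_dim S n.
Proof.
move=> x0P; have Sx0 : S x0 by move=> i; exact: ltW.
exists x0, 1%:M; split=> // [||W' W'S]; first exact: mxrank1.
  by move=> x _; exact: submx1.
apply/row_subP => a.
have [|e e0 eP] := @perturb x0 (row a 1%:M) Sx0.
  by move=> i si; have := x0P i; rewrite si ltxx.
have := W'S _ (eP e _); rewrite gtr0_norm // => /(_ (lexx _)).
by rewrite addrC addKr eqmx_scale ?gt_eqF.
Qed.

Lemma is_face_facet i x : facet P i x -> is_face S (facet P i).
Proof.
move=> ix; split; first by exists x.
exists (- normal P i), (offset P i); split=> [y Sy|].
  by rewrite dotmxNl; have := Sy i; rewrite /slack; lra.
apply/seteqP; split=> y [Sy yi]; split=> //; move: yi;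
  by rewrite dotmxNl /slack; lra.
Qed.

(** [x] is a relative interior point of facet [i], so the facet contains small steps in every
    direction orthogonal to the normal. The point [x0] serves to show that the normal is nonzero. *)
Lemma has_dim_facet i x0 x : 0 < slack P i x0 -> slack P i x = 0 ->
  (forall j, j != i -> 0 < slack P j x) ->
  exists2 d, has_dim (facet P i) d & (d + 1 = n)%N.
Proof.
move=> x0i xi xj.
have Sx : S x by move=> j; have [->|/xj/ltW//] := eqVneq j i; rewrite xi.
have ni0 : normal P i != 0.
  apply: contraTneq x0i => n0.
  by move: xi; rewrite /slack n0 ![dotmx 0 _]dotmxC !linear0 => ->; rewrite ltxx.
have rn : \rank (normal P i)^T = 1%N.
  by rewrite mxrank_tr rank_rV ni0.
have n1 : (1 <= n)%N by rewrite -rn mxrank_tr rank_leq_col.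
exists (n - 1)%N; last by rewrite subnK.
exists x, (kermx (normal P i)^T); split=> [||y [_ yi]|W' W'S].
- by split.
- by rewrite mxrank_ker rn.
- by have := slackD i x (y - x); rewrite sub_kermx_dot subrKC yi xi add0r => <-.
apply/row_subP => a; set w := row a _.
have wi : dotmx (normal P i) w = 0.
  by apply/eqP; rewrite -sub_kermx_dot row_sub.
have [|e e0 eP] := @perturb x w Sx.
  by move=> j; have [-> //|/xj ji sj] := eqVneq j i; rewrite sj ltxx in ji.
have := W'S (x + e *: w).
rewrite [_ - x]addrC addKr eqmx_scale ?gt_eqF //; apply.
split; first by apply: eP; rewrite gtr0_norm.
by rewrite slackD xi dotmxZr wi mulr0 addr0.
Qed.

(** Dimension counts become strict inequalities: an interior point, and for each [i] a point where
    only the [i]-th slack vanishes. Both kinds of point arise as barycentres. *)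
Lemma polytopeP : polytope P <->
  [/\ exists M : R, forall x, S x -> forall a, `|x 0 a| <= M,
      exists x0, forall i, 0 < slack P i x0 &
      forall i, exists2 x, slack P i x = 0 &
        forall j, j != i -> 0 < slack P j x].
Proof.
split=> [[bP dP [fP iP _]]|[bP [x0 x0P] irr]].
  split=> //.
    have [x0 [_ [Sx0 _ _ _]]] := dP.
    (* Otherwise facet [i] is all of [S], which has dimension n and not n - 1. *)
    have pos i : exists2 y, S y & 0 < slack P i y.
      apply: contrapT => no; have [_ [d [dF dn]]] := fP i Logic.I.
      have FS : facet P i = S.
        apply/seteqP; split=> [y []//|y Sy]; split=> //.
        apply/eqP; rewrite eq_le Sy andbT leNgt; apply/negP => yi.
        by apply: no; exists y.
      rewrite FS in dF; have := has_dim_unique dP dF.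
      by rewrite -dn addn1 => /eqP; rewrite -[X in _ == X]addn0 -addn1 eqn_add2l.
    (* The extra index [None] keeps the family nonempty even when there are no inequalities. *)
    pose y (o : option I) := if o is Some i then s2val (cid2 (pos i)) else x0.
    have [|x [Sx xP _]] := @average (option I) y None.
      by case=> [i|//] /=; case: cid2.
    exists x => i; apply: (xP i (Some i)) => /=; by case: cid2.
  move=> i; have [iF [d [dF dn]]] := fP i Logic.I; have [[x0 ix0] _] := iF.
  (* Otherwise facet [i] lies in facet [j]; having equal dimension they span the same hyperplane and
     coincide, against injectivity of [facet P]. *)
  have pos j : j != i -> exists2 y, facet P i y & 0 < slack P j y.
    move=> ji; apply: contrapT => no; have [_ [d' [dF' dn']]] := fP j Logic.I.
    have dd : d' = d by apply/eqP; rewrite -(eqn_add2r 1) dn dn'.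
    rewrite {}dd in dF'.
    have FF : facet P i `<=` facet P j.
      move=> y iy; have [Sy _] := iy; split=> //.
      apply/eqP; rewrite eq_le Sy andbT leNgt; apply/negP => yj.
      by apply: no; exists y.
    have FF' : facet P j `<=` facet P i.
      move=> y jy; have [Sy _] := jy; split=> //.
      have := @same_dim_hyperplane _ _ _ _ _ x0 (normal P i) (- offset P i)
        FF dF dF' ix0 _ y jy.
      rewrite /slack => ->; first by rewrite addNr.
      by move=> z [_]; rewrite /slack; lra.
    move/eqP: ji; apply; apply: iP; rewrite ?inE //.
    by apply/seteqP; split.
  have pos' j : exists2 y, facet P i y & j != i -> 0 < slack P j y.
    have [->|/pos[y iy yj]] := eqVneq j i; first by exists x0.
    by exists y.
  have [|x [Sx xP xi]] := @average I (fun j => s2val (cid2 (pos' j))) i.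
    by move=> j; case: cid2 => y /= [].
  exists x => [|j ji]; last by apply: (xP j j); case: cid2 => y /= _; apply.
  rewrite /slack (xi _ (- offset P i)) ?addNr // => j.
  by case: cid2 => y /= [_]; rewrite /slack; lra.
split=> //; first exact: has_dim_interior x0P.
have fP i : codim_face S 1 (facet P i).
  have [x xi xj] := irr i; have [d dF dn] := has_dim_facet (x0P i) xi xj.
  split; last by exists d.
  apply: (@is_face_facet i x); split=> // j.
  by have [->|/xj/ltW//] := eqVneq j i; rewrite xi.
split=> [i _|i j _ _ ij|F [[[z Fz] [u [c [uS FE]]]] [d [dF dn]]]].
- exact: fP.
- apply/eqP; apply: contraTT (isT) => ij'; have [x xi xj] := irr i.
  have : facet P i x.
    by split=> // k; have [->|/xj/ltW//] := eqVneq k i; rewrite xi.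
  rewrite ij => -[_ xj0]; have := xj j; rewrite eq_sym ij' xj0 ltxx.
  by move=> /(_ isT).
- have dFS : F `<=` S by rewrite FE => x [].
  (* If no slack vanishes on all of [F], the barycentre is an interior point of [S] maximizing [u];
     then [u] is 0 and [F] is [S], of the wrong dimension. Once [F] lies in facet [i], equal
     dimensions make [u] constant on that facet. *)
  have [i iF] : exists i, forall x, F x -> slack P i x = 0.
    apply: contrapT => no.
    have pos i : exists2 y, F y & 0 < slack P i y.
      apply: contrapT => no'; apply: no; exists i => x Fx.
      apply/eqP; rewrite eq_le dFS // andbT leNgt; apply/negP => yi.
      by apply: no'; exists x.
    pose y (o : option I) := if o is Some i then s2val (cid2 (pos i)) else z.
    have Fy o : F (y o) by case: o => [i|//] /=; case: cid2.
    have [|x [Sx xP uxc]] := @average (option I) y None.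
      by move=> o; apply: dFS.
    have xpos i : 0 < slack P i x.
      by apply: (xP i (Some i)) => /=; case: cid2.
    have ux : dotmx u x = c by apply: uxc => o; have := Fy o; rewrite FE => -[].
    (* Moving along [u] itself raises the value of [u] by [e] times its squared norm. *)
    have [|e e0 eP] := @perturb x u Sx.
      by move=> i si; have := xpos i; rewrite si ltxx.
    have := uS _ (eP e _); rewrite gtr0_norm // => /(_ (lexx _)).
    rewrite linearD /= ux gerDl dotmxZr pmulr_rle0 // => uu.
    have u0 : u = 0 by apply: dotmx_eq0; apply/eqP; rewrite eq_le uu dotmx_ge0.
    have FS : F = S.
      rewrite FE; apply/seteqP; split=> [w []//|w Sw]; split=> //.
      by rewrite -ux u0 !(dotmxC 0) !linear0.
    rewrite FS in dF; have := has_dim_unique dF (has_dim_interior xpos).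
    by lia.
  exists i => //.
  have [_ [d' [dF' dn']]] := fP i.
  have dd : d' = d by lia.
  rewrite {}dd in dF'.
  have FF : F `<=` facet P i by move=> x Fx; split; [exact: dFS|exact: iF].
  apply/seteqP; split=> // x ix; rewrite FE; split; first by case: ix.
  apply: (same_dim_hyperplane FF dF dF' Fz) => // w.
  by rewrite FE => -[].
Qed.

End Polyhedron.

Section Nerve.
Variables (R : realType) (n : nat) (I : finType) (P : ineqs R n I).
Local Notation S := (polyhedron P).

Lemma nerve0 x : S x -> nerve P finset.set0.
Proof. by move=> Sx; exists x; split=> // i; rewrite inE. Qed.

Lemma nerveS (s t : {set I}) : s \subset t -> nerve P t -> nerve P s.
Proof.
move=> /fintype.subsetP st [x [Sx xt]]; exists x; split=> // i /st.
exact: xt.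
Qed.

(** A bounded polyhedron contains no ray. The step [t] is taken so that [t * w] has [a]-th
    coordinate of modulus M + |x_a| + 1, which pushes the new point beyond the bound. *)
Lemma bounded_recession M x w : (forall y, S y -> forall a, `|y 0 a| <= M) ->
  S x -> (forall i, 0 <= dotmx (normal P i) w) -> w = 0.
Proof.
move=> bS Sx wP; apply/rowP => a; rewrite mxE; apply/eqP.
rewrite -normr_eq0 eq_le normr_ge0 andbT leNgt; apply/negP => wa.
have M0 : 0 <= M by exact: le_trans (bS _ Sx a).
pose t := (M + `|x 0 a| + 1) / `|w 0 a|.
have t0 : 0 <= t by rewrite divr_ge0 // !addr_ge0.
have /bS/(_ a) : S (x + t *: w).
  by move=> i; rewrite slackD dotmxZr; apply: addr_ge0; [exact: Sx|exact: mulr_ge0].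
have := ler_normB (x 0 a + t * w 0 a) (x 0 a).
rewrite addrC addKr normrM (ger0_norm t0) divfK ?gt_eqF // !mxE.
by lra.
Qed.

(** If all slacks vanish at [x], the vector from [x] to an interior point is a nonzero recession
    direction. *)
Lemma nerve_setT (i0 : I) : polytope P -> ~ nerve P [set: I]%SET.
Proof.
move=> /polytopeP[[M bS] [y yP] _] [x [Sx xP]].
have x0 i : slack P i x = 0 by have [|_] := xP i; rewrite ?inE.
have d i : dotmx (normal P i) (y - x) = slack P i y.
  by have := slackD P i x (y - x); rewrite subrKC x0 add0r => <-.
have : y - x = 0.
  by apply: (bounded_recession bS Sx) => i; rewrite d ltW.
by move=> yx; have := yP i0; rewrite -d yx linear0 ltxx.
Qed.

(** The homogenized inequalities cut out the cone over the polytope. At height 0 only a recession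
    direction could remain; at negative height [u - s *: y], with [y] interior, would be a nonzero
    one. *)
Lemma homogeneous_cases (i0 : I) u s : polytope P ->
  (forall i, 0 <= dotmx (normal P i) u + offset P i * s) ->
  (s = 0 /\ u = 0) \/ (0 < s /\ exists2 y, S y & u = s *: y).
Proof.
move=> /polytopeP[[M bS] [y yP] _] uP.
have Sy : S y by move=> i; exact: ltW.
case: (ltgtP s 0) => s0.
- have d i : dotmx (normal P i) (u - s *: y) =
    dotmx (normal P i) u + offset P i * s + (- s) * slack P i y.
    by rewrite linearB /= dotmxZr /slack; lra.
  have : u - s *: y = 0.
    apply: (bounded_recession bS Sy) => i; rewrite d addr_ge0 //.
    by apply: mulr_ge0; [rewrite oppr_ge0; exact: ltW|exact: ltW].
  move=> uy; have : 0 < dotmx (normal P i0) (u - s *: y).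
    by rewrite d ltr_wpDl // mulr_gt0 ?oppr_gt0.
  by rewrite uy linear0 ltxx.
- right; split=> //; exists (s^-1 *: u); last first.
    by rewrite scalerA divff ?gt_eqF ?scale1r.
  move=> i; rewrite /slack dotmxZr.
  have -> : s^-1 * dotmx (normal P i) u + offset P i =
      s^-1 * (dotmx (normal P i) u + offset P i * s).
    by rewrite mulrDr [offset _ _ * _]mulrC mulKf ?gt_eqF.
  by rewrite mulr_ge0 ?invr_ge0 // ltW.
- left; split=> //; apply: (bounded_recession bS Sy) => i.
  by have := uP i; rewrite s0 mulr0 addr0.
Qed.

Lemma slack_bounded M i (x : 'rV[R]_n) : (forall a, `|x 0 a| <= M) ->
  slack P i x <= \sum_a `|normal P i 0 a| * M + `|offset P i|.
Proof.
move=> xM; rewrite /slack lerD ?ler_norm // dotmxE ler_sum // => a _.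
apply: le_trans (ler_norm _) _; rewrite normrM ler_wpM2l //.
Qed.

End Nerve.

Section Composed.
Variables (R : realType) (n m : nat) (j nn : 'I_m -> nat).
Variables (P : ineqs R n 'I_m) (Q : forall i, ineqs R (nn i) 'I_(j i)).
Local Notation C := (composed_polytope P Q).
Local Notation tg := (Tagged (fun i => 'I_(j i))).

Definition join (x : 'rV[R]_n) (u : forall i, 'rV[R]_(nn i)) :
    'rV[R]_(n + \sum_i nn i) := row_mx x (\mxrow_i u i).

Lemma joinP z : exists x u, z = join x u.
Proof.
exists (lsubmx z), (fun i => submxrow (rsubmx z) i).
by rewrite /join submxrowK hsubmxK.
Qed.

Lemma slack_join x u i (a : 'I_(j i)) :
  slack C (tg a) (join x u) =
  dotmx (normal (Q i) a) (u i) + offset (Q i) a * slack P i x.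
Proof.
rewrite /slack /= /dotmx /join tr_row_mx mul_row_col mxE.
rewrite -scalemxAl [X in X + _ + _]mxE tr_mxrow mul_mxrow_mxcol.
rewrite (bigD1 i) //= eqxx conform_mx_id big1 ?addr0 => [|l li]; last first.
  by rewrite (negPf li) mul0mx.
by rewrite mulrDr addrA [X in X + _]addrC.
Qed.

Lemma slack_join_scale x u i (a : 'I_(j i)) y :
  u i = slack P i x *: y ->
  slack C (tg a) (join x u) = slack P i x * slack (Q i) a y.
Proof. by move=> uE; rewrite slack_join uE dotmxZr [offset _ _ * _]mulrC -mulrDr. Qed.

Hypothesis j0 : forall i, 'I_(j i).
Hypothesis hP : polytope P.
Hypothesis hQ : forall i, polytope (Q i).

Lemma composed_cases x u i : polyhedron C (join x u) ->
  (slack P i x = 0 /\ u i = 0) \/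
  (0 < slack P i x /\ exists2 y, polyhedron (Q i) y & u i = slack P i x *: y).
Proof.
move=> xuC; apply: (homogeneous_cases (j0 i)) => // a.
by rewrite -slack_join; exact: xuC.
Qed.

Lemma composed_base x u : polyhedron C (join x u) -> polyhedron P x.
Proof. by move=> xuC i; case: (composed_cases i xuC) => [[->]|[/ltW]]. Qed.

(** Where slack [i] of the base point is positive, the [i]-th slot rescales to a point of [Q i] on
    the same facets. Where it is zero, the slot is 0 and lies on all of its facets. *)
Lemma nerve_composed :
  nerve C = composed_complex (nerve P) (fun i => nerve (Q i)).
Proof.
apply/seteqP; split=> [tau [z [zC ztau]]|tau [s [x [Sx xs]] sP]].
  have [x [u zE]] := joinP z; rewrite {}zE in zC ztau.
  exists [set i | slack P i x == 0]%SET.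
    exists x; split=> [|i]; first exact: composed_base zC.
    by rewrite inE => /eqP xi; split=> //; exact: composed_base zC.
  move=> i; rewrite inE; case: eqP => // xi.
  case: (composed_cases i zC) => [[/xi//]|[si [y Sy uE]]].
  exists y; split=> // a; rewrite inE => /ztau[_ ].
  by rewrite (slack_join_scale _ uE) => /eqP; rewrite mulf_eq0 gt_eqF //= => /eqP.
have ex i : exists u, (forall a, 0 <= dotmx (normal (Q i) a) u +
      offset (Q i) a * slack P i x) /\
    (forall a, tg a \in tau ->
      dotmx (normal (Q i) a) u + offset (Q i) a * slack P i x = 0).
  (* The split is on the slack and not on [s], because [x] may lie on facets outside [s]. *)
  have [xi0|xi0] := eqVneq (slack P i x) 0.
    by exists 0; split=> a; rewrite linear0 xi0 mulr0 addr0.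
  have iNs : i \notin s by apply: contra_neqN xi0 => /xs[].
  move: (sP i); rewrite (negPf iNs) => -[y [Sy ytau]].
  have E a : dotmx (normal (Q i) a) (slack P i x *: y) +
      offset (Q i) a * slack P i x = slack P i x * slack (Q i) a y.
    by rewrite dotmxZr [offset _ _ * _]mulrC -mulrDr.
  exists (slack P i x *: y); split=> a; rewrite E; first by rewrite mulr_ge0.
  move=> atau; have [|_ ->] := ytau a; first by rewrite inE.
  by rewrite mulr0.
pose u i := sval (cid (ex i)).
have uP i := svalP (cid (ex i)).
have zC : polyhedron C (join x u).
  by case=> i a; rewrite (@slack_join x u i a); exact: (uP i).1.
exists (join x u); split=> // -[i a] iatau; split=> //.
by rewrite (@slack_join x u i a); exact: (uP i).2.
Qed.

Lemma polytope_composed : polytope C.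
Proof.
have [[M bP] [x0 x0P] irrP] := (polytopeP P).1 hP.
have hQ' i := (polytopeP (Q i)).1 (hQ i).
apply/polytopeP; split.
- have exM i : exists M : R, forall x, polyhedron (Q i) x ->
      forall a, `|x 0 a| <= M by case: (hQ' i).
  pose L i := sval (cid (exM i)).
  have LP i := svalP (cid (exM i)).
  pose B i := \sum_a `|normal P i 0 a| * M + `|offset P i|.
  (* A coordinate in slot [i] is a slack of [P], at most [B i], times a coordinate of a point of
     [Q i], at most [L i]. *)
  exists (`|M| + \sum_i `|B i * L i|) => z.
  have [x [u ->]] := joinP z => zC a.
  have Sx := composed_base zC; rewrite /join mxE.
  case: fintype.splitP => r _.
    apply: le_trans (bP _ Sx r) _; apply: le_trans (ler_norm _) _.
    by rewrite lerDl sumr_ge0.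
  rewrite mxE; set i := tagnat.sig1 r; set b := tagnat.sig2 r.
  suff : `|u i 0 b| <= `|B i * L i|.
    move=> /le_trans; apply; rewrite (bigD1 i) //= addrCA lerDl.
    by rewrite addr_ge0 // sumr_ge0.
  case: (composed_cases i zC) => [[_ ->]|[si [y Sy ->]]].
    by rewrite mxE normr0.
  rewrite mxE normrM normrM (ger0_norm (ltW si)) ler_pM ?(ltW si) //.
    apply: le_trans (ler_norm _); exact: slack_bounded (bP _ Sx).
  exact: le_trans (LP i y Sy b) (ler_norm _).
- have ex i : exists y, forall a, 0 < slack (Q i) a y by case: (hQ' i).
  exists (join x0 (fun i => slack P i x0 *: sval (cid (ex i)))) => -[i a].
  rewrite (@slack_join_scale x0 _ i a (sval (cid (ex i)))) //.
  by rewrite mulr_gt0 //; case: cid.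
- move=> [i a].
  (* Over the interior base point [x0], slot [i] takes a point on facet [a] alone and every other
     slot an interior point. *)
  have ex l : exists y, forall b : 'I_(j l), if tg b == tg a
      then slack (Q l) b y = 0 else 0 < slack (Q l) b y.
    have [_ [y yP] irr] := hQ' l.
    have [E|li] := eqVneq l i.
      subst l; have [w wa wb] := irr a; exists w => b.
      by rewrite eq_Tagged /=; case: eqP => [->//|/eqP/wb].
    exists y => b; case: eqP => // E; case/eqP: li; exact: (congr1 (@tag _ _) E).
  pose u l := slack P l x0 *: sval (cid (ex l)).
  have uE l b : slack C (tg b) (join x0 u) =
      slack P l x0 * slack (Q l) b (sval (cid (ex l))).
    exact: slack_join_scale.
  exists (join x0 u).
    rewrite uE; have := svalP (cid (ex i)) a.
    by rewrite eqxx => ->; rewrite mulr0.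
  move=> [l b] ne; rewrite (uE l b) mulr_gt0 //.
  have := svalP (cid (ex l)) b.
  by rewrite (negPf ne).
Qed.

End Composed.

(** * Vertices and the kernel torus *)

Section Vertex.
Variables (R : realType) (n : nat) (I : finType) (P : ineqs R n I).
Implicit Types (u v x y w p : 'rV[R]_n) (i : I).
Local Notation S := (polyhedron P).

Lemma dotmx_sqrD x y :
  dotmx (x + y) (x + y) = dotmx x x + 2 * dotmx y x + dotmx y y.
Proof.
rewrite linearD /= [dotmx _ x]dotmxC [dotmx _ y]dotmxC !linearD /=.
by rewrite [dotmx x y]dotmxC; lra.
Qed.

Lemma continuous_dotmx u : continuous (dotmx u).
Proof.
rewrite (_ : dotmx u = fun x => \sum_a u 0 a * x 0 a); last first.
  by apply/funext => x; rewrite dotmxE.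
apply: continuous_big => [|a _]; first exact: add_continuous.
move=> x; exact: (@cvgM _ _ (nbhs x) _ (fun=> u 0 a) (fun x => x 0 a) _ _
  (cvg_cst _) (@coord_continuous _ _ _ 0 a x)).
Qed.

Lemma compact_polyhedron M : (forall x, S x -> forall a, `|x 0 a| <= M) ->
  compact S.
Proof.
move=> bS; apply: bounded_closed_compact.
  exists `|M|; split; first exact: num_real.
  move=> c Mc x Sx; rewrite /Num.Def.normr /= mx_normrE.
  apply/bigmax_leP; split=> [|[a b] _ /=]; first exact: le_trans (ltW Mc).
  rewrite ord1 (le_trans (bS _ Sx b)) //.
  exact: le_trans (ler_norm _) (ltW Mc).
rewrite (_ : S = \bigcap_i (slack P i @^-1` [set r | 0 <= r])); last first.
  apply/seteqP; split=> [x Sx i _|x Sx i]; first exact: Sx.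
  exact: (Sx i Logic.I).
apply: closed_bigI => i _; apply: closed_comp; last exact: closed_ge.
move=> x _; exact: (@cvgD _ _ _ (nbhs x) _ (dotmx (normal P i))
  (fun=> offset P i) _ _ (@continuous_dotmx _ x) (cvg_cst _)).
Qed.

(* A point of S farthest from p is a vertex, exposed by the direction from p. *)
Lemma farthest_vertex p : polytope P -> exists v,
  [/\ S v, is_face S [set v] &
    forall x, S x -> dotmx (x - p) (x - p) <= dotmx (v - p) (v - p)].
Proof.
move=> /polytopeP[[M bS] [x0 x0P] _].
have Sx0 : S x0 by move=> i; exact: ltW.
pose f x := dotmx (x - p) (x - p).
have cf : continuous f.
  rewrite (_ : f = fun x => \sum_a (x 0 a - p 0 a) * (x 0 a - p 0 a)).
    apply: continuous_big => [|a _]; first exact: add_continuous.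
    move=> x.
    have cx : (y 0 a - p 0 a : R) @[y --> x] --> (x 0 a - p 0 a : R).
      apply: cvgB; last exact: cvg_cst.
      exact: (@coord_continuous _ _ _ 0 a x).
    exact: (@cvgM _ _ (nbhs x) _ _ _ _ _ cx cx).
  by apply/funext => x; rewrite /f dotmxE; apply: eq_bigr => a _; rewrite !mxE.
have [v /set_mem Sv vP] : exists2 v, v \in S & forall x, x \in S -> f x <= f v.
  apply: compact_EVT_max; first by exists x0.
    exact: compact_polyhedron bS.
  exact: continuous_subspaceT.
have {}vP x : S x -> f x <= f v by move=> Sx; exact/vP/mem_set.
exists v; split=> //; split; first by exists v.
(* Maximality of the distance at [v], expanded around [v]: the functional [v - p] is largest at [v],
   and equality forces [x] = [v]. *)
have key x : S x ->
    2 * dotmx (v - p) (x - v) + dotmx (x - v) (x - v) <= 0.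
  move=> /vP; rewrite /f.
  have -> : x - p = (x - v) + (v - p) by rewrite addrA subrK.
  by rewrite dotmx_sqrD; lra.
exists (v - p), (dotmx (v - p) v); split=> [x /key|].
  have := dotmx_ge0 (x - v); rewrite [dotmx (v - p) (x - v)]linearB /=; lra.
apply/seteqP; split=> [_ ->//|x [/key + xv]].
rewrite [dotmx (v - p) (x - v)]linearB /= xv subrr mulr0 add0r => xv0.
apply/eqP; rewrite -subr_eq0; apply/eqP/dotmx_eq0/eqP.
by rewrite eq_le xv0 dotmx_ge0.
Qed.

Lemma vertex_off_facet i : polytope P ->
  exists v, [/\ S v, is_face S [set v] & slack P i v != 0].
Proof.
move=> hP; have [[M bS] [y yP] _] := (polytopeP P).1 hP.
(* Seen from -t times the inward normal, the interior point [y] gains 2t times its slack over points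
   of the facet. This gain is set to n M^2 + 1, whereas a squared norm is at most n M^2, so the
   farthest vertex is off the facet. *)
pose t := (\sum_(a < n) M ^+ 2 + 1) / (2 * slack P i y).
have si := yP i.
have tE : 2 * t * slack P i y = \sum_(a < n) M ^+ 2 + 1.
  by rewrite /t; field; rewrite gt_eqF.
have [v [Sv fv vP]] := farthest_vertex (- t *: normal P i) hP.
exists v; split=> //; apply/eqP => vi.
have : S y by move=> k; exact: ltW.
move=> /vP; rewrite !scaleNr !opprK.
have E x : dotmx (x + t *: normal P i) (x + t *: normal P i) =
    dotmx x x + 2 * t * (slack P i x - offset P i) +
    t * t * dotmx (normal P i) (normal P i).
  by rewrite dotmx_sqrD !dotmxZl dotmxZr /slack; lra.
rewrite !E vi sub0r.
have vM : dotmx v v <= \sum_(a < n) M ^+ 2.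
  rewrite dotmxE ler_sum // => a _; rewrite -expr2.
  rewrite -(real_normK (num_real (v 0 a))) ler_pXn2r ?nnegrE // ?bS //.
  exact: le_trans (bS _ Sv a).
by have := dotmx_ge0 y; lra.
Qed.

Lemma exists_vertex : polytope P -> exists v, S v /\ is_face S [set v].
Proof. by move=> /(farthest_vertex 0)[v [Sv fv _]]; exists v. Qed.

(** For [x] on all facets through [v], short steps from [v] along both [x - v] and its opposite stay
    in [S]. The functional exposing [v] is then constant along that line, so [x] = [v]. *)
Lemma vertex_facet_meet v : S v -> is_face S [set v] ->
  facet_meet P [set i | slack P i v == 0]%SET = [set v].
Proof.
move=> Sv [_ [u [c [uS vE]]]].
have uv : dotmx u v = c by have : [set v] v by []; rewrite vE => -[].
apply/seteqP; split=> [x [Sx xP]|_ ->]; last first.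
  by split=> // i; rewrite inE => /eqP vi; split.
have [|e e0 eP] := @perturb _ _ _ P v (x - v) Sv.
  move=> i vi; have [|_] := xP i; first by rewrite inE vi.
  by rewrite -[X in slack P i X](subrKC v) slackD vi add0r.
have S1 : S (v + e *: (x - v)) by apply: eP; rewrite gtr0_norm.
have S2 : S (v + - e *: (x - v)) by apply: eP; rewrite normrN gtr0_norm.
have := uS _ S1; have := uS _ S2.
rewrite !linearD /= !dotmxZr uv => h1 h2.
have ud : e * dotmx u (x - v) = 0 by lra.
have : [set v] (v + e *: (x - v)).
  by rewrite vE; split=> //; rewrite linearD /= dotmxZr uv ud addr0.
move=> /eqP; rewrite -subr_eq0 addrC addKr scaler_eq0 gt_eqF //= subr_eq0.
by move=> /eqP.
Qed.

Lemma codim_vertex v : S v -> is_face S [set v] ->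
  codim_face S n (facet_meet P [set i | slack P i v == 0]%SET).
Proof.
move=> Sv fv; rewrite vertex_facet_meet //; split=> //.
exists 0%N; split=> //; exists v, 0; split=> //; first exact: mxrank0.
  by move=> _ ->; rewrite subrr sub0mx.
by move=> W' _; exact: sub0mx.
Qed.

End Vertex.

(** The determinant multiplies all of Z^n into the span, by the adjugate, so it kills the
    complement; the complement is torsion-free, hence zero. The columns of the inverse solve M c =
    e_k. *)
Lemma full_rank_summand n l (M : 'M[int]_(n, l)) : l = n ->
  \rank (map_mx (intr : int -> rat) M) = l -> direct_summand (int_span M) ->
  exists B, M *m B = 1%:M.
Proof.
move=> ln; move: M; rewrite {}ln => M rM [S' [S'0 S'B dec capS]].
have dM : \det M != 0.
  have : map_mx (intr : int -> rat) M \in unitmx.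
    by rewrite -row_free_unit /row_free rM.
  by rewrite unitmxE unitfE det_map_mx intr_eq0.
have S'N v : S' v -> S' (- v) by move=> S'v; rewrite -sub0r; exact: S'B.
have S'n v k : S' v -> S' (v *+ k).
  move=> S'v; elim: k => [|k IHk]; first by rewrite mulr0n.
  by rewrite mulrS -[v *+ k]opprK; apply: S'B => //; exact: S'N.
have S'Z v (a : int) : S' v -> S' (a *: v).
  move=> S'v; rewrite -[a]intz scaler_int.
  by case: a => k; [exact: S'n|apply: S'N; exact: S'n].
have ex (v : 'cV[int]_n) : exists c, v = M *m c.
  have [s [s' [[c _ <-] S's' ->]]] := dec v.
  suff -> : s' = 0 by exists c; rewrite addr0.
  have : (int_span M `&` S') (\det M *: s').
    split; last exact: S'Z.
    by exists (\adj M *m s') => //; rewrite mulmxA mul_mx_adj mul_scalar_mx.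
  by rewrite capS => /eqP; rewrite scalemx_eq0 (negPf dM) => /eqP.
exists (\matrix_(a, k) sval (cid (ex (delta_mx k 0))) a 0).
apply/matrixP => a k; have E := svalP (cid (ex (delta_mx k 0))).
have := congr1 (fun A : 'cV_n => A a 0) E; rewrite !mxE eqxx andbT => ->.
by apply: eq_bigr => b _; rewrite mxE.
Qed.

(** Simplicity makes the columns of the facets through [v] square, hence invertible over Z. The
    inverse is padded by zero rows, so columns of facets missing [v] can later be deleted. *)
Lemma characteristic_vertex (R : realType) n r (P : ineqs R n 'I_r)
    (mu : 'M[int]_(n, r)) v :
  simple_polytope P -> characteristic P mu -> polyhedron P v ->
  is_face (polyhedron P) [set v] ->
  exists B : 'M[int]_(r, n), mu *m B = 1%:M /\
    forall i, slack P i v != 0 -> row i B = 0.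
Proof.
move=> [_ sP] cmu Sv fv; set s := [set i | slack P i v == 0]%SET.
have sn : #|s| = n by exact: sP.
have [|rM dM] := cmu s; first by rewrite sn; exact: codim_vertex.
have [B MB] := full_rank_summand sn rM dM.
exists (colsub (fun c : 'I_#|s| => enum_val c) 1%:M *m B).
split=> [|i vi]; first by rewrite mulmxA mulmx_colsub mulmx1.
rewrite row_mul (_ : row i _ = 0) ?mul0mx //; apply/rowP => c; rewrite !mxE.
case: eqP => // ic; have := enum_valP c; rewrite -ic inE => vi0.
by rewrite vi0 in vi.
Qed.

Lemma characteristic_surj (R : realType) n r (P : ineqs R n 'I_r)
    (mu : 'M[int]_(n, r)) :
  simple_polytope P -> characteristic P mu -> exists B, mu *m B = 1%:M.
Proof.
move=> hP cmu; have [v [Sv fv]] := exists_vertex hP.1.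
by have [B [muB _]] := characteristic_vertex hP cmu Sv fv; exists B.
Qed.

(* The columns at a vertex off the last facet already span. *)
Lemma characteristic_lsubmx_surj (R : realType) n k (P : ineqs R n 'I_(k + 1))
    (mu : 'M[int]_(n, k + 1)) :
  simple_polytope P -> characteristic P mu -> exists B, lsubmx mu *m B = 1%:M.
Proof.
move=> hP cmu.
have [v [Sv fv vi]] := vertex_off_facet (rshift k ord0) hP.1.
have [B [muB B0]] := characteristic_vertex hP cmu Sv fv.
exists (usubmx B); rewrite -muB -[in RHS](hsubmxK mu) -[in RHS](vsubmxK B).
rewrite mul_row_col (_ : dsubmx B = 0) ?mulmx0 ?addr0 //.
apply/row_matrixP => i; rewrite row_dsubmx row0 ord1; exact: B0.
Qed.

Lemma lambdaJN_surj n m (lam : 'M[int]_(n, m)) (nn k : 'I_m -> nat)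
    (lams : forall i, 'M[int]_(nn i, k i + 1)) :
  (exists B, lam *m B = 1%:M) ->
  (forall i, exists B, lsubmx (lams i) *m B = 1%:M) ->
  exists B, lambdaJN lam lams *m B = 1%:M.
Proof.
move=> [B2 B2P] ex1; pose B1 i := sval (cid (ex1 i)).
have B1P i : lsubmx (lams i) *m B1 i = 1%:M := svalP (cid (ex1 i)).
rewrite /lambdaJN; set A := mxblock _; set C := mxcol _.
pose Bd := \mxblock_(i, i') (if i == i' then conform_mx 0 (B1 i) else 0) :
  'M[int]_(\sum_i k i, \sum_i nn i).
have ABd : A *m Bd = 1%:M.
  rewrite /A /Bd mul_mxblock -mxdiagZ /mxdiag; apply: eq_mxblock => i l.
  rewrite (bigD1 i) //= eqxx conform_mx_id big1 ?addr0 => [|l' ll']; last first.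
    by rewrite eq_sym (negPf ll') mul0mx.
  case: eqP => [il|_]; last by rewrite mulmx0.
  by subst l; rewrite !conform_mx_id B1P.
(* The corner block solves A X + C B2 = 0. *)
exists (block_mx Bd (- (Bd *m C *m B2)) 0 B2).
rewrite mulmx_block !mulmx0 !mul0mx !addr0 add0r B2P mulmxN !mulmxA ABd mul1mx.
by rewrite addNr -scalar_mx_block.
Qed.

(** * Topology of the complex plane, subspaces and orbit spaces *)

Lemma continuous_prod_topology (I : Type) (T : I -> topologicalType)
    (S : topologicalType) (f : S -> prod_topology T) :
  (forall i, continuous (fun x => f x i)) -> continuous f.
Proof.
move=> cf x; apply/cvg_sup => i.
exact: (@continuous_comp_initial _ S (T i) (fun g : prod_topology T => g i)
  (f : S -> initial_topology _) (cf i) x).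
Qed.

Lemma continuous_val (T : topologicalType) (A : set T) :
  continuous (val : A -> T).
Proof. exact: initial_continuous. Qed.

Lemma continuous_set_type (T S : topologicalType) (A : set T) (f : S -> A) :
  continuous (fun x => val (f x)) -> continuous f.
Proof. exact: continuous_comp_initial. Qed.

Lemma compact_set_type (T : topologicalType) (A : set T) :
  compact A -> compact [set: A].
Proof.
move=> cA F FF _.
have [] := cA (val @ F).
  apply: (@filterS _ F _ setT); last exact: filterT.
  by move=> x _; exact: set_valP.
move=> p [Ap clp]; exists (SigSub (mem_set Ap)); split=> // B C FB.
move=> [_ [[W oW <-] /= Wp WC]].
have [||_ [[b Bb <-] Wb]] := clp (val @` B) W.
- by apply: (@filterS _ F _ B) => // b Bb; exists b.
- exact: open_nbhs_nbhs.
- by exists b; split=> //; exact: WC.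
Qed.

Section Orbits.
Variables (R : realType) (G : Type) (X1 X2 : topologicalType).
Variables (act1 : G -> X1 -> X1) (act2 : G -> X2 -> X2).
Variables (H : set G) (Y1 : set X1) (Y2 : set X2).

Local Notation Q1 := (orbit_space act1 H Y1).
Local Notation Q2 := (orbit_space act2 H Y2).

Lemma eq_pi_orbit (X : topologicalType) (act : G -> X -> X) (Y : set X)
    (x y : Y) :
  orbit_of act H (val x) = orbit_of act H (val y) <->
  \pi_(orbit_space act H Y) x = \pi_(orbit_space act H Y) y.
Proof. by split=> [/asboolP xy|/eqmodP/asboolP //]; apply/eqmodP. Qed.

Hypothesis act1P : forall x y, orbit_of act1 H x = orbit_of act1 H y <->
  exists2 g, H g & y = act1 g x.
Hypothesis act2P : forall x y, orbit_of act2 H x = orbit_of act2 H y <->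
  exists2 g, H g & y = act2 g x.
Hypothesis act2Y : forall g x, H g -> Y2 x -> Y2 (act2 g x).
Hypothesis act2c : forall g, H g -> continuous (act2 g).

(** The saturation of [A] contains, around each of its points, the preimage of [A] under some
    [act2 g], which is continuous. *)
Lemma open_pi_orbit (A : set Y2) : open A -> open [set \pi_Q2 a | a in A].
Proof.
move=> oA.
suff : open (\pi_Q2 @^-1` [set \pi_Q2 a | a in A]) by [].
rewrite openE => y [a Aa /eq_pi_orbit/esym/act2P[g Hg ya]].
pose act' (x : Y2) : Y2 :=
  SigSub (mem_set (act2Y Hg (set_valP x)) : act2 g (val x) \in Y2).
have cact' : continuous act'.
  apply: continuous_set_type => x /=.
  apply: (@continuous_comp _ _ _ (val : Y2 -> X2) (act2 g)).
    exact: continuous_val.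
  exact: act2c.
have ay : a = act' y by exact/val_inj.
have : nbhs (act' y) A by rewrite -ay; apply: open_nbhs_nbhs; split.
move=> /cact' nA; apply: (@filterS _ (nbhs y) _ (act' @^-1` A)) nA => z Az.
exists (act' z) => //.
by apply/esym/eq_pi_orbit/act2P; exists g.
Qed.

Variables (phi : Y1 -> Y2) (psi : Y2 -> Y1) (h : Y2 * unit_interval R -> Y2).
Hypothesis cphi : continuous phi.
Hypothesis cpsi : continuous psi.
Hypothesis ch : continuous h.
Hypothesis phiE : forall g x y, H g -> val y = act1 g (val x) ->
  val (phi y) = act2 g (val (phi x)).
Hypothesis psiE : forall g x y, H g -> val y = act2 g (val x) ->
  val (psi y) = act1 g (val (psi x)).
Hypothesis hE : forall g x y t, H g -> val y = act2 g (val x) ->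
  val (h (y, t)) = act2 g (val (h (x, t))).
Hypothesis phiK : cancel phi psi.
Hypothesis h0 : forall y t, val t = 0 -> h (y, t) = phi (psi y).
Hypothesis h1 : forall y t, val t = 1 -> h (y, t) = y.

Lemma orbit_homotopy_equivalent : homotopy_equivalent R Q1 Q2.
Proof.
pose f (q : Q1) := \pi_Q2 (phi (repr q)).
pose g (q : Q2) := \pi_Q1 (psi (repr q)).
pose k (p : Q2 * unit_interval R) := \pi_Q2 (h (repr p.1, p.2)).
have fE x : f (\pi_Q1 x) = \pi_Q2 (phi x).
  apply/eq_pi_orbit/act2P.
  have /eq_pi_orbit/act1P[u Hu xE] : \pi_Q1 (repr (\pi_Q1 x)) = \pi_Q1 x.
    exact: reprK.
  by exists u => //; exact: phiE.
have gE x : g (\pi_Q2 x) = \pi_Q1 (psi x).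
  apply/eq_pi_orbit/act1P.
  have /eq_pi_orbit/act2P[u Hu xE] : \pi_Q2 (repr (\pi_Q2 x)) = \pi_Q2 x.
    exact: reprK.
  by exists u => //; exact: psiE.
have kE x t : k (\pi_Q2 x, t) = \pi_Q2 (h (x, t)).
  apply/eq_pi_orbit/act2P.
  have /eq_pi_orbit/act2P[u Hu xE] : \pi_Q2 (repr (\pi_Q2 x)) = \pi_Q2 x.
    exact: reprK.
  by exists u => //; exact: hE.
exists f, g; split.
- apply/quotient_continuous => x.
  rewrite (_ : f \o _ = \pi_Q2 \o phi); last by apply/funext => y /=; exact: fE.
  by apply: continuous_comp; [exact: cphi|exact: pi_continuous].
- apply/quotient_continuous => x.
  rewrite (_ : g \o _ = \pi_Q1 \o psi); last by apply/funext => y /=; exact: gE.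
  by apply: continuous_comp; [exact: cpsi|exact: pi_continuous].
(* [g] after [f] is the identity on the nose, so the constant homotopy suffices. *)
- exists fst; split=> [|x t _|x t _] //; first by move=> p; exact: cvg_fst.
  by rewrite -[x]reprK /= fE gE phiK.
- exists k; split=> [|x t t0|x t t1]; last 2 first.
  + by rewrite -[x]reprK /= gE fE kE h0.
  + by rewrite -[x]reprK /= kE h1.
  (* A quotient map times the identity of the interval need not be a quotient map. Instead, a box
     around a representative is pushed down by the open orbit map. *)
  move=> [q t] U.
  rewrite -[q]reprK kE => /pi_continuous/ch nU.
  have {nU} : nbhs (repr q, t) (h @^-1` (\pi_Q2 @^-1` U)) by [].
  move=> [[A B] /= [nA nB] ABU].
  exists ([set \pi_Q2 a | a in A^°], B) => /=.
    split=> //; apply: open_nbhs_nbhs; split; first exact/open_pi_orbit/open_interior.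
    by exists (repr q).
  by move=> [_ s] [/= [a /interior_subset Aa <-] Bs]; rewrite kE; exact: ABU.
Qed.

End Orbits.

Section ComplexPlane.
Variable R : realType.
Local Notation C := R[i].
Implicit Types (z w : C) (x : R).

Lemma normrcE z : `|z| = (Normc.normc z)%:C.
Proof. by []. Qed.

Lemma normc_ge0 z : 0 <= Normc.normc z.
Proof. by rewrite -ler0c -normrcE. Qed.

Lemma normc_real x : Normc.normc x%:C = `|x|.
Proof. by rewrite /Normc.normc /= expr0n addr0 sqrtr_sqr. Qed.

Lemma normr_le1c z : (`|z| <= 1) = (Normc.normc z <= 1).
Proof. by rewrite normrcE -lecR. Qed.

Lemma normr_eq1c z : (`|z| == 1) = (Normc.normc z == 1).
Proof. by rewrite normrcE -[1 in LHS]/(1%:C) (inj_eq (@complexI _)). Qed.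

Lemma near_normc z (e : R) : 0 < e -> \forall w \near z, Normc.normc (z - w) < e.
Proof.
move=> e0; have e0' : 0 < e%:C by rewrite ltcR.
have : nbhs z (ball z e%:C) by exact: nbhsx_ballx.
by apply: (@filterS _ (nbhs z) _ (ball z e%:C)) => w; rewrite -ball_normE /= ltcR.
Qed.

Lemma continuous_normc : continuous (@Normc.normc R).
Proof.
move=> z; apply/(@cvgrPdist_lt _ _ _ (nbhs z)) => e e0.
apply: (@filterS _ (nbhs z) _ _ _ _ (near_normc z e0)) => w zw.
apply: le_lt_trans zw; rewrite ler_norml.
have h1 := le_normcD (z - w : Rcomplex R) w.
have h2 := le_normcD (w - z : Rcomplex R) z.
rewrite !subrK in h1 h2; rewrite lerNl opprB !lerBlDr h1 andbT.
by rewrite -(normcN (w - z)) opprB in h2.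
Qed.

Lemma continuous_real_complex : continuous (real_complex R : R -> C).
Proof.
(* Radii of balls live in [R[i]], where being positive forces the imaginary part to vanish. *)
move=> x; apply/(@cvgrPdist_lt _ _ _ (nbhs x)) => e.
rewrite ltcE => /andP[/eqP/= e1 e0].
have eE : e = (complex.Re e)%:C by case: e e1 e0 => a b /= ->.
near=> y; rewrite -rmorphB normrcE normc_real eE ltcR.
near: y; have : nbhs x (ball x (complex.Re e)) by exact: nbhsx_ballx.
by apply: (@filterS _ (nbhs x) _ (ball x (complex.Re e))) => y; rewrite -ball_normE.
Unshelve. all: by end_near. Qed.

Lemma compact_unit_disc : compact (unit_disc R).
Proof.
pose f (p : R * R) : C := p.1%:C + 'i%C * p.2%:C.
have cf : continuous f.
  move=> p; apply: cvgD.
    by apply: (@continuous_comp _ _ _ fst (real_complex R));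
      [exact: cvg_fst|exact: continuous_real_complex].
  apply: cvgM; first exact: cvg_cst.
  by apply: (@continuous_comp _ _ _ snd (real_complex R));
      [exact: cvg_snd|exact: continuous_real_complex].
have cI : compact (`[-1, 1] : set R) by exact: segment_compact.
have cS : compact (f @` (`[-1, 1] `*` `[-1, 1])).
  by apply: continuous_compact; [exact: continuous_subspaceT|
     exact: compact_setX].
apply: (subclosed_compact _ cS).
  rewrite (_ : unit_disc R = @Normc.normc R @^-1` [set x | x <= 1]).
    by apply: closed_comp; [move=> z _; exact: continuous_normc|exact: closed_le].
  by apply/seteqP; split=> z; rewrite /unit_disc /= normr_le1c.
move=> [a b]; rewrite /unit_disc /= normr_le1c /= => ab1.
have ab : a ^+ 2 + b ^+ 2 <= 1.
  rewrite -(ler_sqrt _ ler01) sqrtr1 //.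
exists (a, b).
  split; rewrite /= in_itv /= -ler_norml -(ler_pXn2r (ltn0Sn 1)) ?nnegrE //;
  rewrite real_normK ?num_real // expr1n; apply: le_trans ab.
    by rewrite lerDl sqr_ge0.
  by rewrite lerDr sqr_ge0.
by rewrite /f [RHS]complexE.
Qed.

Lemma compact_unit_circle : compact (unit_circle R).
Proof.
apply: (subclosed_compact _ compact_unit_disc); last first.
  by move=> z /= z1; rewrite /unit_disc /= z1.
rewrite (_ : unit_circle R = @Normc.normc R @^-1` [set 1]).
  by apply: closed_comp; [move=> z _; exact: continuous_normc|exact: closed_eq].
apply/seteqP; split=> z; rewrite /unit_circle /= => /eqP.
  by rewrite normr_eq1c => /eqP.
by rewrite -normr_eq1c => /eqP.
Qed.

End ComplexPlane.

(** * The cone on a moment-angle complex *)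

Section ConeFill.
Variables (R : realType) (V : finType) (K : set {set V}).
Local Notation CV := (prod_topology (fun _ : V => R[i])).
Local Notation Z := (moment_angle R K).
Local Notation mod := (@Normc.normc R).
Implicit Types (z : CV) (c : R).

Hypothesis K0 : K finset.set0.
Hypothesis KS : forall s t : {set V}, s \subset t -> K t -> K s.
Hypothesis KT : ~ K [set: V]%SET.

(** The coordinates off the unit circle form the smallest simplex that can witness membership. *)
Lemma moment_angleP z :
  Z z <-> (forall v, mod (z v) <= 1) /\ K [set v | mod (z v) != 1]%SET.
Proof.
split=> [[s Ks zs]|[z1 Kz]].
  split=> [v|].
    move: (zs v); case: ifP => _; rewrite /unit_disc /unit_circle /=.
      by rewrite normr_le1c.
    by move=> zv; rewrite -normr_le1c zv.
  apply: KS Ks; apply/fintype.subsetP => v; rewrite inE -normr_eq1c.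
  by move: (zs v); case: ifP => // _ zv; rewrite zv eqxx.
exists [set v | mod (z v) != 1]%SET => // v; rewrite inE.
case: eqP => /= [/eqP zv|_]; last by rewrite /unit_disc /= normr_le1c.
by apply/eqP; rewrite normr_eq1c.
Qed.

(** For a simplicial complex, the largest c <= 1 such that the coordinates of modulus below c form a
    simplex. The default value 1 of the minimum is the cap. *)
Definition depth z : R :=
  \big[Num.max/0]_(s : {set V} | `[< K s >])
    \big[Num.min/1]_(v | v \notin s) mod (z v).

Lemma le_depthP c z : reflect
  (c <= 1 /\ exists2 s, K s & forall v, v \notin s -> c <= mod (z v))
  (c <= depth z).
Proof.
apply: (iffP (bigmax_geP _ _ _ _)) => [[c0|[s /asboolP Ks /bigmin_geP[c1 cs]]]|].
- split; first exact: le_trans c0 ler01.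
  by exists finset.set0 => // v _; exact: le_trans c0 (normc_ge0 _).
- by split=> //; exists s.
- move=> [c1 [s Ks cs]]; right; exists s; first exact/asboolP.
  exact/bigmin_geP.
Qed.

Lemma depth_ge0 z : 0 <= depth z.
Proof.
by apply/le_depthP; split=> //; exists finset.set0 => // v _; exact: normc_ge0.
Qed.

Lemma depth_le1 z : depth z <= 1.
Proof. by have /le_depthP[] := lexx (depth z). Qed.

Lemma eq_depth z w : (forall v, mod (z v) = mod (w v)) -> depth z = depth w.
Proof. by move=> zw; apply: eq_bigr => s _; apply: eq_bigr => v _; rewrite zw. Qed.

(** Upper bound: a simplex is never all of [V], and any coordinate outside it has modulus at most c.
    Lower bound: off the simplex of [z] every coordinate has modulus exactly c. *)
Lemma depth_moment_angle z c : Z z -> 0 <= c -> c <= 1 ->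
  depth (fun v => c%:C * z v) = c.
Proof.
move=> /moment_angleP[z1 Kz] c0 c1; apply/eqP; rewrite eq_le; apply/andP; split.
  have /le_depthP[_ [s Ks /(_ _ _)cs]] := lexx (depth (fun v => c%:C * z v)).
  have [/eqP sT|] := boolP (s == [set: V]%SET); first by rewrite sT in Ks.
  rewrite -finset.subTset => /fintype.subsetPn[v _ vs].
  apply: le_trans (cs _ vs) _; rewrite Normc.normcM normc_real ger0_norm //.
  by rewrite ler_piMr.
apply/le_depthP; split=> //; exists [set v | mod (z v) != 1]%SET => // v.
by rewrite inE negbK Normc.normcM normc_real ger0_norm // => /eqP ->; rewrite mulr1.
Qed.

Lemma depth1 z : Z z -> depth z = 1.
Proof.
move=> Zz; rewrite -(depth_moment_angle Zz ler01 (lexx _)).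
by apply: eq_depth => v; rewrite mul1r.
Qed.

Lemma continuous_depth : continuous depth.
Proof.
have pc v : continuous (fun z : CV => mod (z v)).
  move=> z; apply: (@continuous_comp _ _ _ (fun z : CV => z v) mod).
    exact: (@proj_continuous V (fun=> R[i]) v).
  exact: continuous_normc.
apply: continuous_big => [p|s _].
  by apply: continuous_max; [exact: cvg_fst|exact: cvg_snd].
apply: continuous_big => [p|v _ //].
by apply: continuous_min; [exact: cvg_fst|exact: cvg_snd].
Qed.

(** The factor is min(1, depth / |z_v|), written so that the denominator vanishes only if both depth
    and z_v do. *)
Definition clip z : CV :=
  fun v => (depth z / Num.max (depth z) (mod (z v)))%:C * z v.

Lemma mod_clip z v : mod (clip z v) <= depth z.
Proof.
have d0 := depth_ge0 z.
rewrite Normc.normcM normc_real ger0_norm ?divr_ge0 ?le_max ?d0 //.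
rewrite -mulrA ler_piMr // mulrC.
have [->|m0] := eqVneq (Num.max (depth z) (mod (z v))) 0.
  by rewrite invr0 mulr0 ler01.
rewrite ler_pdivrMr ?mul1r ?le_max ?lexx ?orbT //.
by rewrite lt_neqAle eq_sym m0 le_max d0.
Qed.

Lemma continuous_clip : continuous clip.
Proof.
apply: continuous_prod_topology => v z.
have cz : continuous (fun z : CV => z v).
  exact: (@proj_continuous V (fun=> R[i]) v).
have cm : continuous (fun z : CV => Num.max (depth z) (mod (z v))).
  move=> w; apply: continuous_max; first exact: continuous_depth.
  apply: (@continuous_comp _ _ _ (fun z : CV => z v) mod); first exact: cz.
  exact: continuous_normc.
(* At depth 0 the quotient need not be continuous; the bound of [clip] by the depth, which tends to
   0, replaces it. *)
have [dz0|dz0] := eqVneq (depth z) 0.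
  have c0 : clip z v = 0.
    by apply/Normc.eq0_normc/eqP; rewrite eq_le normc_ge0 -dz0 mod_clip.
  rewrite /continuous_at c0; apply/(@cvgr0Pnorm_lt _ _ _ (nbhs z)) => e.
  rewrite ltcE => /andP[/eqP/= e1 e0].
  have eE : e = (complex.Re e)%:C by case: e e1 e0 => a b /= ->.
  have := @continuous_depth z; rewrite /continuous_at dz0.
  move=> /(@cvgr0Pnorm_lt _ _ _ (nbhs z))/(_ _ e0).
  apply: (@filterS _ (nbhs z)) => w; rewrite ger0_norm ?depth_ge0 // => we.
  by rewrite eE normrcE ltcR (le_lt_trans (mod_clip w v)).
have m0 : Num.max (depth z) (mod (z v)) != 0.
  by rewrite gt_eqF // lt_max lt_neqAle eq_sym dz0 depth_ge0.
pose q (w : CV) : R := depth w / Num.max (depth w) (mod (w v)).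
have cq : {for z, continuous q}.
  have cV : {for z, continuous (fun w : CV => (Num.max (depth w) (mod (w v)))^-1)}.
    exact: (@cvgV _ _ (nbhs z) _
      (fun w : CV => Num.max (depth w) (mod (w v))) _ m0 (cm z)).
  exact: (@cvgM _ _ (nbhs z) _ depth
    (fun w : CV => (Num.max (depth w) (mod (w v)))^-1)
    _ _ (continuous_depth (x := z)) cV).
have cq' : {for z, continuous (fun w => (q w)%:C : R[i])}.
  apply: (@continuous_comp _ _ _ q (real_complex R)) => //.
  exact: continuous_real_complex.
exact: (@cvgM _ _ (nbhs z) _ (fun w => (q w)%:C : R[i]) (fun w => w v) _ _
  cq' (cz z)).
Qed.

Lemma clip_moment_angle z : Z z -> clip z = z.
Proof.
move=> Zz; apply/funext => v; rewrite /clip depth1 //.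
by case/moment_angleP: Zz => z1 _; rewrite max_l // divr1 mul1r.
Qed.

Lemma compact_moment_angle : compact Z.
Proof.
pose B (s : {set V}) : set CV :=
  [set z | forall v, (if v \in s then unit_disc R else unit_circle R) (z v)].
have -> : Z = \big[setU/set0]_(s in [pred s | `[< K s >]]) B s.
  rewrite -bigcup_pred; apply/seteqP; split=> z [s Ks zs].
    exists s; first exact/asboolP.
    by move=> v; move: (zs v); case: (v \in s).
  exists s; first by move: Ks => /asboolP.
  by move=> v; move: (zs v); case: (v \in s).
apply: bigsetU_compact => s _.
apply: (@tychonoff V (fun=> R[i])
  (fun v => if v \in s then unit_disc R else unit_circle R)) => v.
by case: ifP => _; [exact: compact_unit_disc|exact: compact_unit_circle].
Qed.

End ConeFill.

Section ConeEmbedding.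
Variables (R : realType) (V : finType) (K : set {set V}).
Local Notation CV := (prod_topology (fun _ : V => R[i])).
Local Notation Z := (moment_angle R K).
Local Notation CZ := (cone R Z).
Local Notation mod := (@Normc.normc R).
Implicit Types (z : CV).

Definition cone_fill (c : CZ) : CV :=
  fun v => (1 - val (repr c).2)%:C * val (repr c).1 v.

(** Representatives differ only at the apex, where the factor 1 - t is zero. *)
Lemma cone_fill_pi (x : Z) (t : unit_interval R) :
  cone_fill (\pi_CZ (x, t)) = fun v => (1 - val t)%:C * val x v.
Proof.
have /eqmodP : \pi_CZ (repr (\pi_CZ (x, t))) = \pi_CZ (x, t) by rewrite reprK.
rewrite /cone_fill; case: (repr _) => y s /= /orP[/eqP[-> ->] //|].
by move=> /andP[/= /eqP -> /eqP ->]; apply/funext => v; rewrite subrr !mul0r.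
Qed.

Lemma continuous_cone_fill : continuous cone_fill.
Proof.
apply/quotient_continuous; apply: continuous_prod_topology => v [x t].
rewrite (_ : (fun p => _) =
    (fun p : Z * unit_interval R => (1 - val p.2)%:C * val p.1 v)); last first.
  by apply/funext => -[y s] /=; rewrite cone_fill_pi.
apply: cvgM.
  apply: (@continuous_comp _ _ _ (fun p : Z * unit_interval R => 1 - val p.2)
    (real_complex R)); last exact: continuous_real_complex.
  apply: cvgB; first exact: cvg_cst.
  apply: (@continuous_comp (Z * unit_interval R)%type (unit_interval R) R snd
    (fun t => val t)); first exact: cvg_snd.
  exact: (@continuous_val R (unit_interval R)).
apply: (@continuous_comp _ _ _ fst (fun y : Z => val y v)); first exact: cvg_fst.
apply: (@continuous_comp Z CV _ (fun y => val y) (fun z : CV => z v)).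
  exact: continuous_val.
exact: (@proj_continuous V (fun=> R[i]) v).
Qed.

Lemma cone_fill_base (x : Z) : cone_fill (cone_base R x) = val x.
Proof. by rewrite cone_fill_pi; apply/funext => v; rewrite subr0 mul1r. Qed.

Lemma cone_fill_map (f : Z -> Z) (t : torus R V) (c : CZ) :
  (forall x, val (f x) = torus_act t (val x)) ->
  cone_fill (cone_map f c) = torus_act t (cone_fill c).
Proof.
move=> fE; rewrite cone_fill_pi /cone_fill; apply/funext => v.
by rewrite fE /torus_act mulrCA.
Qed.

Lemma mod_torus_act (t : torus R V) z v : mod (torus_act t z v) = mod (z v).
Proof.
rewrite /torus_act Normc.normcM.
have /eqP : `|val (t v)| = 1 := set_valP (t v).
by rewrite normr_eq1c => /eqP ->; rewrite mul1r.
Qed.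

Lemma clip_torus_act (t : torus R V) z :
  clip K (torus_act t z) = torus_act t (clip K z).
Proof.
apply/funext => v; rewrite /clip mod_torus_act.
rewrite (@eq_depth _ _ K _ z); last by move=> w; rewrite mod_torus_act.
by rewrite /torus_act mulrCA.
Qed.

Hypothesis K0 : K finset.set0.
Hypothesis KS : forall s t : {set V}, s \subset t -> K t -> K s.
Hypothesis KT : ~ K [set: V]%SET.

Lemma unit_intervalP (t : unit_interval R) : 0 <= val t <= 1.
Proof. by have := set_valP t; rewrite /unit_interval /= in_itv. Qed.

Lemma depth_cone_fill (x : Z) (t : unit_interval R) :
  depth K (cone_fill (\pi_CZ (x, t))) = 1 - val t.
Proof.
rewrite cone_fill_pi depth_moment_angle //; first exact: set_valP.
  by rewrite subr_ge0; case/andP: (unit_intervalP t).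
by rewrite lerBlDr lerDl; case/andP: (unit_intervalP t).
Qed.

(** The depth of the image gives back the cone parameter, and away from the apex division by 1 - t
    gives back the point. *)
Lemma cone_fill_inj : injective cone_fill.
Proof.
move=> c d; rewrite -(reprK c) -(reprK d).
case: (repr c) (repr d) => [x t] [y s] E.
have /(congr1 (fun r => 1 - r)) := congr1 (depth K) E.
rewrite !depth_cone_fill !subKr => ts; apply/eqmodP => /=.
have [t1|t1] := eqVneq (val t) 1.
  have s1 : val s = 1 by rewrite -ts.
  by apply/orP; right; apply/andP; split; exact/eqP.
apply/orP; left; apply/eqP; congr (_, _); last exact: val_inj.
apply: val_inj; apply/funext => v.
move: E; rewrite !cone_fill_pi -ts => /(congr1 (@^~ v)) /mulfI; apply.
by rewrite -[0]/(0%:C) (inj_eq (@complexI _)) subr_eq0 eq_sym.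
Qed.

Lemma clip_cone_fill c : clip K (cone_fill c) = cone_fill c.
Proof.
rewrite -(reprK c); case: (repr c) => x t; apply/funext => v.
rewrite /clip depth_cone_fill cone_fill_pi Normc.normcM normc_real.
have /andP[t0 t1] := unit_intervalP t.
have t1' : 0 <= 1 - val t by rewrite subr_ge0.
rewrite ger0_norm // max_l; last first.
  rewrite ler_piMr //.
  by have /(moment_angleP KS)[] := set_valP x.
have [->|t1n] := eqVneq (1 - val t) 0; first by rewrite mul0r rmorph0 !mul0r.
by rewrite divff // mul1r.
Qed.

Lemma unit_torus_moment_angle : (fun=> 1 : R[i]) \in Z.
Proof.
apply/mem_set/(moment_angleP KS); split=> [v|]; first by rewrite Normc.normc1.
by apply: KS K0; apply/fintype.subsetP => v; rewrite inE Normc.normc1 eqxx.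
Qed.

(** Dividing [clip K z] by the depth lands in Z(K): coordinates of modulus at least the depth become
    unimodular, and the others lie in the simplex that attains the depth. *)
Lemma cone_fill_clip z : exists c, cone_fill c = clip K z.
Proof.
have d0 := depth_ge0 K0 z; have d1 := depth_le1 K0 z.
have tI : 1 - depth K z \in unit_interval R.
  by apply/mem_set; rewrite /unit_interval /= in_itv /= subr_ge0 d1 lerBlDr lerDl.
(* Here [clip] vanishes and the preimage is the apex; the all-ones point only provides a
   representative. *)
have [dz|dz] := eqVneq (depth K z) 0.
  exists (\pi_CZ ((SigSub unit_torus_moment_angle : Z),
    (SigSub tI : unit_interval R))).
  apply/funext => v; rewrite cone_fill_pi /= dz subr0 subrr mul0r.
  by rewrite /clip dz mul0r mul0r.
have dp : 0 < depth K z by rewrite lt_neqAle eq_sym dz d0.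
pose x v := (Num.max (depth K z) (mod (z v)))^-1%:C * z v.
have mx v : mod (x v) = mod (z v) / Num.max (depth K z) (mod (z v)).
  rewrite Normc.normcM normc_real ger0_norm 1?mulrC //.
  by rewrite invr_ge0 le_max d0.
have mp v : 0 < Num.max (depth K z) (mod (z v)) by rewrite lt_max dp.
have Zx : x \in Z.
  apply/mem_set/(moment_angleP KS); split=> [v|].
    by rewrite mx ler_pdivrMr // mul1r le_max lexx orbT.
  have /(le_depthP K0)[_ [s Ks sP]] := lexx (depth K z).
  apply: KS Ks; apply/fintype.subsetP => v; rewrite inE mx.
  apply: contraR => vs; rewrite max_r ?sP // divff // gt_eqF //.
  exact: lt_le_trans (sP _ vs).
exists (\pi_CZ ((SigSub Zx : Z), (SigSub tI : unit_interval R))).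
apply/funext => v; rewrite cone_fill_pi /= subKr /clip /x mulrA.
by rewrite rmorphM.
Qed.

Definition cone_retract z : CZ := sval (cid (cone_fill_clip z)).

Lemma cone_retractK z : cone_fill (cone_retract z) = clip K z.
Proof. exact: svalP (cid (cone_fill_clip z)). Qed.

Lemma cone_fillK : cancel cone_fill cone_retract.
Proof. by move=> c; apply: cone_fill_inj; rewrite cone_retractK clip_cone_fill. Qed.

Lemma cone_retract_base (x : Z) : cone_retract (val x) = cone_base R x.
Proof.
apply: cone_fill_inj; rewrite cone_retractK cone_fill_base.
by apply: clip_moment_angle => //; exact: set_valP.
Qed.

Lemma cone_retract_act (f : Z -> Z) (t : torus R V) z :
  (forall x, val (f x) = torus_act t (val x)) ->
  cone_retract (torus_act t z) = cone_map f (cone_retract z).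
Proof.
move=> fE; apply: cone_fill_inj.
by rewrite (cone_fill_map _ fE) !cone_retractK clip_torus_act.
Qed.

Lemma compact_cone : compact [set: CZ].
Proof.
have -> : [set: CZ] = \pi_CZ @` [set: Z * unit_interval R].
  by apply/seteqP; split=> // c _; exists (repr c) => //; exact: reprK.
apply: continuous_compact; first by apply: continuous_subspaceT; exact: pi_continuous.
rewrite -setXTT; apply: compact_setX; apply: compact_set_type.
  exact: compact_moment_angle.
exact: segment_compact.
Qed.

(* A closed set of the compact cone has closed image in the Hausdorff space
   C^V, and its preimage under the retraction is the preimage of that image
   under clip. *)
Lemma continuous_cone_retract : continuous cone_retract.
Proof.
apply/continuous_closedP => A cA.
have -> : cone_retract @^-1` A = clip K @^-1` (cone_fill @` A).
  apply/seteqP; split=> z /=.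
    by move=> Az; exists (cone_retract z) => //; rewrite cone_retractK.
  by move=> [c Ac]; rewrite -cone_retractK => /cone_fill_inj <-.
apply: closed_comp => [z _|]; first exact: continuous_clip.
apply: compact_closed.
  by apply: hausdorff_product => v; exact: norm_hausdorff.
apply: continuous_compact.
  by apply: continuous_subspaceT; exact: continuous_cone_fill.
exact: subclosed_compact compact_cone _.
Qed.

End ConeEmbedding.

(** * Torus actions and the homotopy equivalence *)

(** The group axioms are asked only of the action of [H], since [G] is a bare type. *)
Lemma orbit_ofP (G : Type) (X : topologicalType) (act : G -> X -> X)
    (H : set G) :
  (exists2 e, H e & forall x, act e x = x) ->
  (forall g h, H g -> H h ->
    exists2 k, H k & forall x, act g (act h x) = act k x) ->
  (forall g, H g -> exists2 k, H k & forall x, act k (act g x) = x) ->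
  forall x y, orbit_of act H x = orbit_of act H y <->
    exists2 g, H g & y = act g x.
Proof.
move=> [e He actE] actM actV x y; split=> [xy|[g Hg ->]].
  have [g Hg gx] : orbit_of act H x y by rewrite xy; exists e.
  by exists g.
apply/seteqP; split=> _ [h Hh <-].
  have [k Hk kE] := actV _ Hg; have [l Hl lE] := actM _ _ Hh Hk.
  by exists l => //; rewrite -lE kE.
by have [l Hl lE] := actM _ _ Hh Hg; exists l => //; rewrite lE.
Qed.

Section Torus.
Variables (R : realType) (V : finType).
Local Notation CV := (prod_topology (fun _ : V => R[i])).

Lemma unit_circle1 : (1 : R[i]) \in unit_circle R.
Proof. by apply/mem_set; rewrite /unit_circle /= normr1. Qed.

Lemma unit_circleV (s : unit_circle R) : (val s)^-1 \in unit_circle R.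
Proof.
by apply/mem_set; rewrite /unit_circle /= normfV (set_valP s) invr1.
Qed.

Definition torus1 : torus R V := fun=> exist _ 1 unit_circle1.

Definition torus_inv (t : torus R V) : torus R V :=
  fun v => exist _ (val (t v))^-1 (unit_circleV (t v)).

Lemma unit_circle_neq0 (s : unit_circle R) : val s != 0.
Proof. by rewrite -normr_eq0 (set_valP s) oner_eq0. Qed.

Lemma torus_act1 (z : CV) : torus_act torus1 z = z.
Proof. by apply/funext => v; rewrite /torus_act mul1r. Qed.

Lemma torus_actM (s t : torus R V) (z : CV) :
  torus_act s (torus_act t z) = torus_act (torus_mul s t) z.
Proof. by apply/funext => v; rewrite /torus_act mulrA. Qed.

Lemma torus_actV (t : torus R V) (z : CV) :
  torus_act (torus_inv t) (torus_act t z) = z.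
Proof.
by apply/funext => v; rewrite /torus_act /= mulKf // unit_circle_neq0.
Qed.

Lemma continuous_torus_act (t : torus R V) : continuous (torus_act t).
Proof.
apply: continuous_prod_topology => v z.
exact: (@cvgM _ _ (nbhs z) _ (fun=> val (t v)) (fun z : CV => z v) _ _
  (cvg_cst _) (@proj_continuous V (fun=> R[i]) v z)).
Qed.

End Torus.

Section CompositionEquivalence.
Variables (R : realType) (m : nat) (j : 'I_m -> nat).
Variables (K : set {set 'I_m}) (Ks : forall i, set {set 'I_(j i)}).
Arguments Ks : clear implicits.
Local Notation V := {i & 'I_(j i)}.
Local Notation CV := (prod_topology (fun _ : V => R[i])).
Local Notation X1 := (prod_topology (cone_moment_angle R Ks)).
Local Notation Y1 := (cone_product R K Ks).
Local Notation Y2 := (moment_angle R (composed_complex K Ks)).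
Local Notation mod := (@Normc.normc R).
Local Notation tg := (Tagged (fun i => 'I_(j i))).

Definition fiber (T : Type) (z : V -> T) (i : 'I_m) (a : 'I_(j i)) : T :=
  z (tg a).
Arguments fiber {T} z i a.

Hypothesis Ks0 : forall i, Ks i finset.set0.
Hypothesis KsS : forall i (s t : {set 'I_(j i)}), s \subset t -> Ks i t -> Ks i s.
Hypothesis KsT : forall i, ~ Ks i [set: 'I_(j i)]%SET.

(** This is the identification of the moment-angle complex of the composed complex with Z(K;
    (D^2)^j_i, Z(K_i)). *)
Lemma composed_moment_angleP (z : CV) :
  Y2 z <-> exists2 s, K s & forall i,
    (forall a, mod (fiber z i a) <= 1) /\
    (i \notin s -> moment_angle R (Ks i) (fiber z i)).
Proof.
split=> [[tau [s Ks' tauP] zP]|[s Ks' zP]].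
  exists s => // i; split=> [a|si].
    move: (zP (tg a)); case: ifP => _; rewrite /unit_disc /unit_circle /=.
      by rewrite normr_le1c.
    by move=> za; rewrite -normr_le1c /fiber za.
  exists (slice tau i); first by move: (tauP i); rewrite (negPf si).
  by move=> a; rewrite inE; exact: zP.
exists [set v : V | (tag v \in s) || (mod (z v) != 1)]%SET.
  exists s => // i; case: ifP => // si.
  have [_ /(_ (negbT si)) zi] := zP i.
  have [_] := (moment_angleP (@KsS i) _).1 zi; apply: KsS; apply/fintype.subsetP => a.
  by rewrite !inE /= si.
move=> -[i a]; rewrite inE /=; have [zi1 ziZ] := zP i.
case: ifP => [_|/norP/= [_]]; rewrite /unit_disc /unit_circle /=.
  by rewrite normr_le1c; exact: zi1.
by rewrite negbK -normr_eq1c => /eqP.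
Qed.

Definition fill (x : X1) : CV := fun v => cone_fill (x (tag v)) (tagged v).

Definition retract (z : CV) : X1 :=
  fun i => cone_retract (Ks0 i) (@KsS i) (fiber z i).

Lemma fiber_fill x i : fiber (fill x) i = cone_fill (x i).
Proof. by []. Qed.

Lemma fill_inj : injective fill.
Proof.
move=> x y xy; apply/functional_extensionality_dep => i.
by apply: (cone_fill_inj (@Ks0 i) (@KsS i) (@KsT i)); rewrite -!fiber_fill xy.
Qed.

Lemma fiberP (z w : CV) : (forall i, fiber z i = fiber w i) -> z = w.
Proof.
move=> zw; apply/funext => -[i a].
exact: (congr1 (fun f : 'I_(j i) -> R[i] => f a) (zw i)).
Qed.

Lemma fill_act (t : torus R V) x :
  fill (cone_product_act Ks t x) = torus_act t (fill x).
Proof.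
apply/fiberP => i.
exact: (@cone_fill_map _ _ _ (moment_angle_act (fiber t i)) (fiber t i) (x i)).
Qed.

Lemma fill_retract z i : fiber (fill (retract z)) i = clip (Ks i) (fiber z i).
Proof. by rewrite fiber_fill /retract cone_retractK. Qed.

Lemma fillK : cancel fill retract.
Proof.
move=> x; apply/functional_extensionality_dep => i.
by rewrite /retract fiber_fill cone_fillK.
Qed.

Lemma retract_act (t : torus R V) z :
  retract (torus_act t z) = cone_product_act Ks t (retract z).
Proof.
apply/functional_extensionality_dep => i.
exact: (@cone_retract_act _ _ _ _ _ _ (moment_angle_act (fiber t i))).
Qed.

Lemma continuous_fill : continuous fill.
Proof.
apply: continuous_prod_topology => -[i a] x.
apply: (@continuous_comp X1 (cone_moment_angle R Ks i) _ (fun x => x i)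
  (fun c => cone_fill c a)).
  exact: (@proj_continuous _ (cone_moment_angle R Ks) i).
apply: (@continuous_comp (cone_moment_angle R Ks i) _ _ (@cone_fill _ _ _)
  (fun z => z a)).
  exact: continuous_cone_fill.
exact: (@proj_continuous _ (fun=> R[i]) a).
Qed.

Lemma continuous_retract : continuous retract.
Proof.
apply: continuous_prod_topology => i z.
apply: (@continuous_comp CV (prod_topology (fun _ : 'I_(j i) => R[i]))
  (cone_moment_angle R Ks i) (fun z => fiber z i)
  (cone_retract (Ks0 i) (@KsS i))).
  apply: continuous_prod_topology => a.
  exact: (@proj_continuous _ (fun=> R[i]) (tg a)).
exact: continuous_cone_retract.
Qed.

Lemma fill_in x : Y1 x -> Y2 (fill x).
Proof.
move=> [s Ks' xP]; apply/composed_moment_angleP; exists s => // i.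
rewrite fiber_fill; split=> [a|si].
  have := mod_clip (@Ks0 i) (cone_fill (x i)) a.
  rewrite (clip_cone_fill (@Ks0 i) (@KsS i) (@KsT i)) => /le_trans; apply.
  exact: depth_le1.
move: (xP i); rewrite (negPf si) => -[y _ <-].
by rewrite cone_fill_base; exact: set_valP.
Qed.

Lemma retract_in z : Y2 z -> Y1 (retract z).
Proof.
move=> /composed_moment_angleP[s Ks' zP]; exists s => // i.
case: ifP => // si; have [_ /(_ (negbT si))Zz] := zP i.
exists (SigSub (mem_set Zz)) => //.
by rewrite -(cone_retract_base (Ks0 i) (@KsS i) (@KsT i)).
Qed.

Definition slide (p : CV * unit_interval R) : CV := fun v =>
  (val p.2)%:C * p.1 v + (1 - val p.2)%:C * fill (retract p.1) v.

Lemma continuous_slide : continuous slide.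
Proof.
have cI : continuous (fun p : CV * unit_interval R => (val p.2)%:C : R[i]).
  move=> p; apply: (@continuous_comp _ R _ (fun p : CV * unit_interval R => val p.2)
    (real_complex R)); last exact: continuous_real_complex.
  apply: (@continuous_comp _ (unit_interval R) R snd (fun t => val t)).
    exact: cvg_snd.
  exact: (@continuous_val R (unit_interval R)).
have cJ : continuous (fun p : CV * unit_interval R => (1 - val p.2)%:C : R[i]).
  rewrite (_ : (fun p => _) = (fun p => 1 - (val p.2)%:C)); last first.
    by apply/funext => p; rewrite rmorphB.
  move=> p; exact: (@cvgB _ _ _ (nbhs p) _ (fun=> 1 : R[i])
    (fun p : CV * unit_interval R => (val p.2)%:C : R[i]) _ _ (cvg_cst _) (cI p)).
have cz v : continuous (fun p : CV * unit_interval R => p.1 v).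
  move=> p; apply: (@continuous_comp _ CV _ fst (fun z : CV => z v)).
    exact: cvg_fst.
  exact: (@proj_continuous _ (fun=> R[i]) v).
have cf v : continuous (fun p : CV * unit_interval R => fill (retract p.1) v).
  move=> p; apply: (@continuous_comp _ CV _ fst (fun z => fill (retract z) v)).
    exact: cvg_fst.
  apply: (@continuous_comp CV X1 _ retract (fun x => fill x v)).
    exact: continuous_retract.
  apply: (@continuous_comp X1 CV _ fill (fun z => z v)).
    exact: continuous_fill.
  exact: (@proj_continuous _ (fun=> R[i]) v).
apply: continuous_prod_topology => v p.
exact: (@cvgD _ _ _ (nbhs p) _ _ _ _ _
  (@cvgM _ _ (nbhs p) _ _ _ _ _ (cI p) (cz v p))
  (@cvgM _ _ (nbhs p) _ _ _ _ _ (cJ p) (cf v p))).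
Qed.

(** The same [s] serves all along the segment: slots in [s] range over convex polydiscs, and in the
    other slots the point lies in Z(K_i), where [clip] is the identity. *)
Lemma slide_in z t : Y2 z -> Y2 (slide (z, t)).
Proof.
move=> /composed_moment_angleP[s Ks' zP].
apply/composed_moment_angleP; exists s => // i; have [zi1 ziZ] := zP i.
have /andP[t0 t1] := unit_intervalP t.
split=> [a|si].
  have h1 : mod (z (tg a)) <= 1 := zi1 a.
  have h2 : mod (fill (retract z) (tg a)) <= 1.
    rewrite -[fill _ _]/(fiber (fill (retract z)) i a) fill_retract.
    exact: le_trans (mod_clip (@Ks0 i) _ _) (depth_le1 (@Ks0 i) _).
  rewrite /fiber /slide [(z, t).1]/= [(z, t).2]/=.
  move: (fill _ _) h2 => w h2.
  apply: le_trans (@le_normcD _ _ _) _.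
  rewrite !Normc.normcM !normc_real !ger0_norm ?subr_ge0 //.
  by rewrite -[leRHS](subrKC (val t)); apply: lerD; rewrite ler_piMr ?subr_ge0.
have Zz := ziZ si.
rewrite (_ : fiber _ i = fiber z i) //; apply/funext => a.
rewrite {1}/fiber /slide /=.
rewrite -[fill _ _]/(fiber (fill (retract z)) i a) fill_retract.
rewrite (clip_moment_angle (@Ks0 i) (@KsS i) (@KsT i) Zz) /fiber.
by rewrite -mulrDl -rmorphD /= subrKC mul1r.
Qed.

Lemma slide_act (t : torus R V) z c :
  slide (torus_act t z, c) = torus_act t (slide (z, c)).
Proof.
apply/funext => v; rewrite /slide /= retract_act fill_act /torus_act.
by rewrite mulrDr !(mulrCA (val (t v))).
Qed.

Variable H : set (torus R V).
Hypothesis H1 : H (@torus1 R V).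
Hypothesis HM : forall s t, H s -> H t -> H (torus_mul s t).
Hypothesis HV : forall t, H t -> H (torus_inv t).

Lemma composition_homotopy_equivalent :
  homotopy_equivalent R
    (orbit_space (@cone_product_act R m j Ks) H Y1)
    (orbit_space (@torus_act R V) H Y2).
Proof.
pose phi (x : Y1) : Y2 := SigSub (mem_set (fill_in (set_valP x))).
pose psi (z : Y2) : Y1 := SigSub (mem_set (retract_in (set_valP z))).
pose h (p : Y2 * unit_interval R) : Y2 :=
  SigSub (mem_set (slide_in p.2 (set_valP p.1))).
apply: (@orbit_homotopy_equivalent R _ _ _ _ _ H Y1 Y2 _ _ _ _ phi psi h).
(* The action laws on the cone product are read off through the injective equivariant map [fill]. *)
- apply: orbit_ofP => [|s t Hs Ht|t Ht].
  + by exists (@torus1 R V) => // x; apply: fill_inj; rewrite fill_act torus_act1.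
  + exists (torus_mul s t); first exact: HM.
    by move=> x; apply: fill_inj; rewrite !fill_act torus_actM.
  + exists (torus_inv t); first exact: HV.
    by move=> x; apply: fill_inj; rewrite !fill_act torus_actV.
- apply: orbit_ofP => [|s t Hs Ht|t Ht].
  + by exists (@torus1 R V) => // x; rewrite torus_act1.
  + by exists (torus_mul s t); [exact: HM|move=> x; rewrite torus_actM].
  + by exists (torus_inv t); [exact: HV|move=> x; rewrite torus_actV].
- move=> t z _ Yz.
  by apply/set_mem; exact: (moment_angle_torus_act t (SigSub (mem_set Yz))).
- by move=> t _; exact: continuous_torus_act.
- apply: continuous_set_type => x /=.
  apply: (@continuous_comp Y1 X1 _ (fun x => val x) fill).
    exact: continuous_val.
  exact: continuous_fill.
- apply: continuous_set_type => x /=.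
  apply: (@continuous_comp Y2 CV _ (fun x => val x) retract).
    exact: continuous_val.
  exact: continuous_retract.
- apply: continuous_set_type => p /=.
  apply: (@continuous_comp _ (CV * unit_interval R)%type _
    (fun p : Y2 * unit_interval R => (val p.1, p.2)) slide).
    have cv : val q.1 @[q --> p] --> (val p.1 : CV).
      apply: (@continuous_comp _ Y2 CV fst (fun x => val x)).
        exact: cvg_fst.
      exact: continuous_val.
    exact: (@cvg_pair _ CV (unit_interval R) (nbhs p) (nbhs (val p.1 : CV))
      (nbhs p.2) _ _ _ _ _ cv cvg_snd).
  exact: continuous_slide.
- by move=> t x y _ xy; rewrite /= xy fill_act.
- by move=> t x y _ xy; rewrite /= xy retract_act.
- by move=> t x y c _ xy; rewrite /= xy slide_act.
- by move=> x; apply: val_inj; exact: fillK.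
- move=> y t t0; apply: val_inj; apply/funext => v /=.
  by rewrite /slide /= [sval t]t0 mul0r add0r subr0 mul1r.
- move=> y t t1; apply: val_inj; apply/funext => v /=.
  by rewrite /slide /= [sval t]t1 subrr mul0r addr0 mul1r.
Qed.

End CompositionEquivalence.

(** * The kernel of lambda(J, N) *)

Section Monomial.
Variable F : fieldType.

Definition monomial a b (M : 'M[int]_(a, b)) (z : 'I_b -> F) : 'I_a -> F :=
  fun r => \prod_c z c ^ M r c.

(** The rule (z^B)^A = z^(AB), by exchanging products. The coordinates must be nonzero because
    exponents of mixed sign are added. *)
Lemma monomialM a b d (A : 'M[int]_(a, b)) (B : 'M[int]_(b, d)) z :
  (forall c, z c != 0) -> monomial (A *m B) z = monomial A (monomial B z).
Proof.
move=> z0; apply/funext => r; rewrite /monomial.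
under [RHS]eq_bigr => e _ do
  rewrite (big_morph (fun x => x ^ A r e) (fun x y => expfzMl x y _) (exp1rz F _)).
rewrite exchange_big /=; apply: eq_bigr => c _; rewrite mxE.
rewrite (big_morph (fun n => z c ^ n) (fun x y => expfzDr x y (z0 c)) (expr0z _)).
by apply: eq_bigr => e _; rewrite exprz_exp mulrC.
Qed.

Lemma monomial1 b (z : 'I_b -> F) : monomial 1%:M z = z.
Proof.
apply/funext => r; rewrite /monomial (bigD1 r) //= mxE eqxx big1 ?mulr1 //.
by move=> c rc; rewrite mxE eq_sym (negPf rc).
Qed.

Lemma monomial_mul a b (M : 'M[int]_(a, b)) (z w : 'I_b -> F) r :
  monomial M (fun c => z c * w c) r = monomial M z r * monomial M w r.
Proof.
by rewrite /monomial -big_split; apply: eq_bigr => c _; rewrite expfzMl.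
Qed.

Lemma monomial_one a b (M : 'M[int]_(a, b)) : monomial M (fun=> 1) = fun=> 1.
Proof. by apply/funext => r; rewrite /monomial big1 // => c _; rewrite exp1rz. Qed.

End Monomial.

Section TorusMonomial.
Variable R : realType.

Definition torus_monomial p q (A : 'M[int]_(p, q)) (t : torus R 'I_q) :
    'I_p -> R[i] := monomial A (fun c => val (t c)).

Lemma torus_monomial_in p q (A : 'M[int]_(p, q)) (t : torus R 'I_q) r :
  torus_monomial A t r \in unit_circle R.
Proof.
apply/mem_set; rewrite /unit_circle /= /torus_monomial /monomial normr_prod.
apply: big1 => c _; have tc : `|val (t c)| = 1 := set_valP (t c).
have n1 k : `|val (t c) ^+ k| = 1 by rewrite normrX tc expr1n.
case: (A r c) => k; first exact: n1.
by rewrite -[_ ^ _]/((val (t c) ^+ k.+1)^-1) normfV n1 invr1.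
Qed.

Lemma continuous_torus_monomial p q (A : 'M[int]_(p, q)) r :
  continuous (fun t => torus_monomial A t r).
Proof.
have cv c : continuous (fun t : torus R 'I_q => val (t c) : R[i]).
  move=> t; apply: (@continuous_comp (torus R 'I_q) (unit_circle R) _
    (fun t => t c) (fun s => val s)).
    exact: (@proj_continuous 'I_q (fun=> unit_circle R) c).
  exact: continuous_val.
apply: continuous_big => [|c _]; first exact: mul_continuous.
have cX k : continuous (fun t : torus R 'I_q => val (t c) ^+ k : R[i]).
  elim: k => [|k IHk] t; first exact: (@cvg_cst _ (1 : R[i]) _ (nbhs t)).
  under eq_fun do rewrite exprS.
  exact: (@cvgM _ _ (nbhs t) _ _ _ _ _ (cv c t) (IHk t)).
case: (A r c) => k t; first exact: cX.
have t0 : val (t c) ^+ k.+1 != 0 by rewrite expf_neq0 // unit_circle_neq0.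
exact: (@cvgV _ _ (nbhs t) _ (fun t => val (t c) ^+ k.+1) _ t0 (cX k.+1 t)).
Qed.

End TorusMonomial.

Section SplitKernel.
Variables (R : realType) (V : finType) (a q : nat) (M : 'M[int]_(a, a + q)).
Variables (col : 'I_(a + q) -> V) (idx : V -> 'I_(a + q)).
Hypotheses (colK : cancel col idx) (idxK : cancel idx col).
Variable B : 'M[int]_(a + q, a).
Hypothesis MB : M *m B = 1%:M.

Local Notation H := [set t : torus R V |
  forall r, \prod_c val (t (col c)) ^ M r c = 1].

Definition pad (s : torus R 'I_q) : torus R 'I_(a + q) := fun c =>
  if fintype.split c is inr e then s e else exist _ 1 (@unit_circle1 R).

(* In a Smith normal form M = L D U the diagonal of D consists of units, so
   t^M = 1 says that the first a coordinates of t^U are 1. *)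
Lemma unimodular_kernel : exists2 U : 'M[int]_(a + q), U \in unitmx &
  forall t : torus R V, H t <->
    forall r, torus_monomial U (fun c => t (col c)) (lshift q r) = 1.
Proof.
have [L uL [U uU [d _ ME]]] := int_Smith_normal_form M.
set D := \matrix_(i, j) _ in ME.
exists U => // t; set w := fun c => val (t (col c)).
have w0 c : w c != 0 by exact: unit_circle_neq0.
rewrite /torus_monomial; set v := monomial U _.
have v0 c : v c != 0.
  by apply/prodf_neq0 => e _; rewrite expfz_neq0 // unit_circle_neq0.
have DE (r : 'I_a) : monomial D v r = v (lshift q r) ^ d`_r.
  rewrite /monomial (bigD1 (lshift q r)) //= mxE eqxx mulr1n big1 ?mulr1 // => c rc.
  rewrite mxE (_ : (r == c :> nat) = false) ?mulr0n //.
  by apply: contra_neqF rc => /eqP rc; apply/val_inj.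
have dP (r : 'I_a) : exists x, d`_r * x = 1.
  have DX : D *m (U *m B *m L) = 1%:M.
    have : L *m (D *m (U *m B *m L)) = L *m 1%:M.
      by rewrite mulmx1 !mulmxA -ME MB mul1mx.
    by move=> /(congr1 (mulmx (invmx L))); rewrite !mulKmx.
  exists ((U *m B *m L) (lshift q r) r).
  have := congr1 (fun A : 'M[int]_a => A r r) DX; rewrite mxE [RHS]mxE eqxx.
  rewrite (bigD1 (lshift q r)) //= [D _ _]mxE eqxx mulr1n big1 ?addr0 // => c rc.
  rewrite [D _ _]mxE (_ : (r == c :> nat) = false) ?mulr0n ?mul0r //.
  by apply: contra_neqF rc => /eqP rc; apply/val_inj.
have ME' : M = L *m (D *m U) by rewrite mulmxA.
have HE : H t <-> monomial M w = fun=> 1.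
  split=> [Ht|Mw r]; first by apply/funext => r; exact: Ht.
  exact: (congr1 (fun z : 'I_a -> R[i] => z r) Mw).
rewrite HE; split=> [Mw r|vr].
  have : monomial (D *m U) w = fun=> 1.
    have -> : D *m U = invmx L *m M by rewrite ME' mulKmx.
    by rewrite monomialM // Mw monomial_one.
  rewrite monomialM // => /(congr1 (fun z : 'I_a -> R[i] => z r)).
  rewrite DE => vd.
  have [x dx] := dP r.
  (* Raising v^d = 1 to the inverse x of d gives v = 1. *)
  by rewrite -[LHS]expr1z -dx -exprz_exp vd exp1rz.
rewrite ME' monomialM // (_ : monomial (D *m U) w = fun=> 1) ?monomial_one //.
rewrite monomialM //.
by apply/funext => r; rewrite DE vr exp1rz.
Qed.

Lemma continuous_pad : continuous pad.
Proof.
apply: continuous_prod_topology => c; rewrite /pad.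
case: (fintype.split c) => e; first by move=> s; exact: (@cvg_cst _ _ _ (nbhs s)).
exact: (@proj_continuous 'I_q (fun=> unit_circle R) e).
Qed.

(** In the coordinates t^U the kernel is the subtorus whose first a coordinates are 1. Thus [f] pads
    and applies the inverse of [U], and [g] reads the last q coordinates of t^U, continuously on the
    whole torus. *)
Lemma kernel_iso_torus : iso_to_torus H q.
Proof.
have [U uU HU] := unimodular_kernel.
pose f (s : torus R 'I_q) : torus R V :=
  fun v => exist _ (torus_monomial (invmx U) (pad s) (idx v))
    (torus_monomial_in (invmx U) (pad s) (idx v)).
pose g (t : torus R V) : torus R 'I_q :=
  fun e => exist _ (torus_monomial U (fun c => t (col c)) (rshift a e))
    (torus_monomial_in U (fun c => t (col c)) (rshift a e)).
have n0 (p : nat) (t : torus R 'I_p) c : val (t c) != 0.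
  exact: unit_circle_neq0.
have fU s : torus_monomial U (fun c => f s (col c)) = fun c => val (pad s c).
  rewrite /torus_monomial /f /=.
  under [X in monomial _ X]eq_fun do rewrite colK.
  by rewrite -monomialM ?mulmxV ?monomial1.
exists f, g; split.
- apply: continuous_prod_topology => v; apply: continuous_set_type => s.
  apply: (@continuous_comp _ _ _ pad (fun t => torus_monomial (invmx U) t (idx v))).
    exact: continuous_pad.
  exact: continuous_torus_monomial.
- apply: continuous_subspaceT.
  apply: continuous_prod_topology => e; apply: continuous_set_type => t.
  apply: (@continuous_comp (torus R V) (torus R 'I_(a + q)) _
    (fun t c => t (col c)) (fun t => torus_monomial U t (rshift a e))).
    apply: continuous_prod_topology => c.
    exact: (@proj_continuous V (fun=> unit_circle R) (col c)).
  exact: continuous_torus_monomial.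
- move=> s t; apply/funext => v; apply: val_inj.
  rewrite /= /torus_monomial -monomial_mul; congr (monomial _ _ _).
  apply/funext => c; rewrite /pad.
  by case: (fintype.split c) => e /=; rewrite ?mulr1.
- move=> s; apply/funext => e; apply: val_inj.
  by rewrite /= fU /pad (unsplitK (inr e)).
- apply/seteqP; split=> [_ [s _ <-]|t Ht].
    by apply/HU => r; rewrite fU /pad (unsplitK (inl r)).
  exists (g t) => //; apply/funext => v; apply: val_inj => /=.
  rewrite -[in RHS](idxK v); set w := fun c => t (col c).
  have -> : torus_monomial (invmx U) (pad (g t)) =
      monomial (invmx U) (torus_monomial U w).
    congr monomial; apply/funext => c; rewrite /pad.
    rewrite -[in RHS](splitK c); case: (fintype.split c) => e //=.
    by rewrite (HU t).1.
  by rewrite /torus_monomial -monomialM ?mulVmx ?monomial1 // => c; exact: n0.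
Qed.

End SplitKernel.

Lemma right_inverse_leq a b (M : 'M[int]_(a, b)) (B : 'M[int]_(b, a)) :
  M *m B = 1%:M -> (a <= b)%N.
Proof.
move=> /(congr1 (map_mx (intr : int -> rat))); rewrite map_mxM map_mx1 => MB.
by rewrite -(mxrank1 rat a) -MB (leq_trans (mxrankM_maxl _ _)) // rank_leq_col.
Qed.

(** The inequality is proved alongside because [b - a] is a truncated subtraction. *)
Lemma kernel_torus (R : realType) (V : finType) a b (M : 'M[int]_(a, b))
    (col : 'I_b -> V) (idx : V -> 'I_b) :
  cancel col idx -> cancel idx col -> (exists B, M *m B = 1%:M) ->
  (a <= b)%N /\ iso_to_torus [set t : torus R V |
    forall r, \prod_c val (t (col c)) ^ M r c = 1] (b - a).
Proof.
move=> colK idxK [B MB]; have ab := right_inverse_leq MB; split=> //.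
(* The column count is rewritten as a + (b - a), so that the columns split. *)
move: M col idx colK idxK B MB; rewrite -(subnKC ab) => M col idx colK idxK B MB.
by rewrite addKn; exact: kernel_iso_torus colK idxK _ MB.
Qed.

Section KerLambda.
Variables (R : realType) (n m : nat) (lam : 'M[int]_(n, m)) (nn k : 'I_m -> nat).
Variable lams : forall i, 'M[int]_(nn i, k i + 1).
Local Notation V := {i & 'I_(k i + 1)}.

Definition coord_column (v : V) : 'I_(\sum_i k i + m) :=
  match fintype.split (tagged v) with
  | inl a => lshift m (tagnat.Rank (tag v) a)
  | inr _ => rshift (\sum_i k i) (tag v)
  end.

Let widen (p : {i & 'I_(k i)}) : V := Tagged _ (lshift 1 (tagged p)).

Lemma coord_columnK : cancel coord_column (@column_coord m k).
Proof.
move=> [i a]; rewrite /coord_column /=.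
rewrite -[in RHS](splitK a); case: (fintype.split a) => b.
  rewrite /column_coord (unsplitK (inl _)) -[LHS]/(widen (tagnat.sig _)).
  by rewrite tagnat.rankK.
by rewrite (ord1 b) /column_coord (unsplitK (inr _)).
Qed.

Lemma column_coordK : cancel (@column_coord m k) coord_column.
Proof.
move=> c; rewrite /column_coord.
rewrite -[in RHS](splitK c); case: (fintype.split c) => b /=.
  by rewrite /coord_column /= (unsplitK (inl _)) /= tagnat.sig2K.
by rewrite /coord_column /= (unsplitK (inr _)).
Qed.

Lemma ker_lambdaJN1 : ker_lambdaJN R lam lams (@torus1 R V).
Proof. by move=> r; apply: big1 => c _; rewrite exp1rz. Qed.

Lemma ker_lambdaJNM s t : ker_lambdaJN R lam lams s ->
  ker_lambdaJN R lam lams t -> ker_lambdaJN R lam lams (torus_mul s t).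
Proof.
move=> Hs Ht r; under eq_bigr do rewrite expfzMl.
by rewrite big_split /= Hs Ht mulr1.
Qed.

Lemma ker_lambdaJNV t : ker_lambdaJN R lam lams t ->
  ker_lambdaJN R lam lams (torus_inv t).
Proof.
move=> Ht r; under eq_bigr do rewrite /= exprz_inv -invr_expz.
by rewrite prodfV Ht invr1.
Qed.

End KerLambda.

Theorem theorem7p2 (R : realType) (n m : nat)
    (P : ineqs R n 'I_m) (lam : 'M[int]_(n, m))
    (nn k : 'I_m -> nat)
    (Q : forall i : 'I_m, ineqs R (nn i) 'I_(k i + 1))
    (lams : forall i : 'I_m, 'M[int]_(nn i, k i + 1))
    (hP : simple_polytope P) (hlam : characteristic P lam)
    (hQ : forall i : 'I_m, simple_polytope (Q i))
    (hlams : forall i : 'I_m, characteristic (Q i) (lams i)) :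
  let dJ := (\sum_(i < m) (k i + 1))%N in
  let N := (\sum_(i < m) nn i)%N in
  let KP := nerve P in
  let KQ := fun i : 'I_m => nerve (Q i) in
  let KC := composed_complex KP KQ in
  let H := ker_lambdaJN R lam lams in
  [/\ homotopy_equivalent R
        (orbit_space (cone_product_act KQ) H (cone_product R KP KQ))
        (orbit_space (@torus_act R {i : 'I_m & 'I_(k i + 1)}) H
           (moment_angle R KC)),
      polytope (composed_polytope P Q) /\ nerve (composed_polytope P Q) = KC,
      #|{: {i : 'I_m & 'I_(k i + 1)}}| = dJ,
      (n + N <= dJ)%N &
      iso_to_torus H (dJ - (n + N))].
Proof.
move=> dJ N KP KQ KC H.
have j0 i : 'I_(k i + 1) := rshift (k i) ord0.
have pQ i : polytope (Q i) := (hQ i).1.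
have dJE : dJ = (\sum_i k i + m)%N.
  by rewrite /dJ big_split /= sum1_card card_ord.
have [B HB] : exists B, lambdaJN lam lams *m B = 1%:M.
  apply: lambdaJN_surj => [|i]; first exact: characteristic_surj hP hlam.
  exact: characteristic_lsubmx_surj (hQ i) (hlams i).
have [leN isoH] := @kernel_torus R _ _ _ (lambdaJN lam lams) _ _
  (@column_coordK _ _) (@coord_columnK _ _) (ex_intro _ B HB).
have NE : (n + N = \sum_i nn i + n)%N by rewrite addnC.
split; last 2 first.
- by rewrite NE dJE.
- by rewrite NE dJE.
- apply: composition_homotopy_equivalent.
  (* The nerve of each P_i contains the empty simplex because P_i has a point, is closed under
     subsets, and omits the full simplex because P_i is bounded with interior. *)
  + move=> i; have [y [Sy _]] := exists_vertex (pQ i); exact: nerve0 Sy.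
  + by move=> i s t; exact: nerveS.
  + by move=> i; exact: nerve_setT (j0 i) (pQ i).
  + exact: ker_lambdaJN1.
  + exact: ker_lambdaJNM.
  + exact: ker_lambdaJNV.
- by split; [exact: polytope_composed j0 hP.1 pQ|exact: nerve_composed j0 pQ].
- rewrite card_tagged sumnE big_map big_enum.
  by apply: eq_bigr => i _; rewrite card_ord.
Qed.
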